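(* Let $\Gamma$ be a finite connected metric graph with vertices $v_1,\dots,v_V$, and let $q:\Gamma\to\mathbb{R}$ be measurable and bounded with $q(x)\ge0$ for almost all $x\in\Gamma$. Then the perturbed Krein Laplacian acts as $$(-\Delta_{{\rm K},\Gamma,q}f)_e=-f_e''+q_ef_e\quad\text{on each edge }e\in\mathcal{E},$$ and its domain consists of all $f\in\widetilde H^2(\Gamma)\cap H^1(\Gamma)$ such that $$\begin{pmatrix}\partial_\nu f(v_1)\\ \vdots\\ \partial_\nu f(v_V)\end{pmatrix}=\Lambda_q\begin{pmatrix}f(v_1)\\ \vdots\\ f(v_V)\end{pmatrix},$$ where $\Lambda_q$ is the Dirichlet-to-Neumann matrix. Moreover, $\dim\ker(-\Delta_{{\rm K},\Gamma,q})=\dim\ker S^*=V$. If $q=0$ identically, the domain of $-\Delta_{{\rm K},\Gamma}:=-\Delta_{{\rm K},\Gamma,0}$ consists of all $f\in\widetilde H^2(\Gamma)\cap H^1(\Gamma)$ which satisfy $$\begin{pmatrix}\partial_\nu f(v_1)\\ \vdots\\ \partial_\nu f(v_V)\end{pmatrix}=L\begin{pmatrix}f(v_1)\\ \vdots\\ f(v_V)\end{pmatrix},$$ where $L$ is the weighted discrete Laplacian.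
   Context: A finite metric graph $\Gamma$ consists of a finite vertex set $\mathcal{V}$, a finite nonempty edge set $\mathcal{E}$ (loops and multiple edges allowed) and a length function $\ell:\mathcal{E}\to(0,\infty)$; $V=|\mathcal{V}|$. Each edge $e$ is identified with $[0,\ell(e)]$, its two endpoints corresponding to the (possibly equal) vertices incident with $e$. A function $f$ on $\Gamma$ is a collection $(f_e)_{e\in\mathcal{E}}$ of functions $f_e:(0,\ell(e))\to\mathbb{C}$; $f\in L^2(\Gamma)$ means $f_e\in L^2(0,\ell(e))$ for all $e$. $\widetilde H^k(\Gamma)$ is the set of $f\in L^2(\Gamma)$ with $f_e\in H^k(0,\ell(e))$ for all $e$; $H^1(\Gamma)$ is the set of $f\in\widetilde H^1(\Gamma)$ that are continuous at each vertex (all traces at endpoints corresponding to the same vertex $v$ coincide; the common value is $f(v)$). For $f\in\widetilde H^2(\Gamma)$ and $v\in\mathcal{V}$, $\partial_\nu f(v)$ is the sum, over all edge endpoints located at $v$ (both endpoints of a loop at $v$ are counted), of the derivative of $f_e$ at that endpoint taken in the direction pointing towards $v$ (i.e. $f_e'(\ell(e))$ for the endpoint $\ell(e)$ and $-f_e'(0)$ for the endpoint $0$). Let $S$ be the operator in $L^2(\Gamma)$ with $(Sf)_e=-f_e''+q_ef_e$ on each edge and $\operatorname{dom}S=\{f\in\widetilde H^2(\Gamma)\cap H^1(\Gamma): f(v)=\partial_\nu f(v)=0\text{ for each }v\in\mathcal{V}\}$. It is closed, symmetric, densely defined with a positive lower bound; its adjoint $S^*$ acts in the same way on $\operatorname{dom}S^*=\widetilde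 H^2(\Gamma)\cap H^1(\Gamma)$. The perturbed Krein Laplacian $-\Delta_{{\rm K},\Gamma,q}$ is the Krein–von Neumann extension of $S$: the self-adjoint restriction of $S^*$ to $\operatorname{dom}S\dotplus\ker S^*$. The Dirichlet-to-Neumann matrix $\Lambda_q\in\mathbb{C}^{V\times V}$ is the matrix determined by $(\partial_\nu f_*(v_1),\dots,\partial_\nu f_*(v_V))^\top=\Lambda_q(f_*(v_1),\dots,f_*(v_V))^\top$ for all $f_*\in\ker S^*$. The weighted discrete Laplacian $L\in\mathbb{R}^{V\times V}$ has entries: for $i\ne j$, $L_{i,j}=-\sum_{e\text{ connects }v_i\text{ and }v_j}\frac1{\ell(e)}$ if $v_i,v_j$ are adjacent and $L_{i,j}=0$ if they are not adjacent; and $L_{i,i}=\sum\frac1{\ell(e)}$, the sum being over all edges $e$ incident with $v_i$ that are not loops. *)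

(* Defs.v *)
From HB Require Import structures.
From mathcomp Require Import all_boot all_order all_algebra.
From mathcomp Require Import complex.
From mathcomp Require Import all_classical all_reals all_analysis.

Set Implicit Arguments.
Unset Strict Implicit.
Unset Printing Implicit Defensive.

Import Order.TTheory GRing.Theory Num.Theory numFieldNormedType.Exports.
Local Open Scope classical_set_scope.
Local Open Scope ring_scope.
Local Open Scope complex_scope.

(* A function on (0, l) is represented by a total function [R -> T] of which
    only the restriction to ]0, l[ matters.  Elements of L^2 are represented by
    Borel functions (every class has one), and equality in L^2 is [aeeq]. *)

Section Interval.
Context {R : realType}.
Implicit Types (l : R) (f g : R -> R[i]) (phi : R -> R).

Definition aeeq {T : Type} l (f g : R -> T) : Prop :=
  \forall x \ae (@lebesgue_measure R), x \in `]0, l[ -> f x = g x.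

(* [lebesgue_measure] lives on the Borel sigma-algebra; a function is Lebesgue
   measurable iff it agrees almost everywhere with a Borel one. *)
Definition lebesgue_measurable_fun l (h : R -> R) : Prop :=
  exists2 h0 : R -> R, measurable_fun `]0, l[ h0 & aeeq l h h0.

Definition cintegral l f : R[i] :=
  Rintegral (@lebesgue_measure R) `]0, l[ (fun x => complex.Re (f x))
  +i* Rintegral (@lebesgue_measure R) `]0, l[ (fun x => complex.Im (f x)).

Definition L2 l f : Prop :=
  [/\ measurable_fun `]0, l[ (fun x => complex.Re (f x)),
      measurable_fun `]0, l[ (fun x => complex.Im (f x)) &
      (\int[@lebesgue_measure R]_(x in `]0%R, l[)
         ((complex.Re (f x) ^+ 2 + complex.Im (f x) ^+ 2)%R)%:E < +oo)%E].

(* C^1 functions compactly supported in (0, l); they define the same weak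
   derivatives as smooth ones. *)
Definition test_fun l phi : Prop :=
  [/\ forall x, derivable phi x 1,
      continuous (derive1 phi) &
      exists a b : R, [/\ 0 < a, b < l & forall x, x \notin `[a, b] -> phi x = 0]].

Definition is_weak_derivative l f g : Prop :=
  forall phi, test_fun l phi ->
    cintegral l (fun x => f x * (derive1 phi x)%:C)
    = - cintegral l (fun x => g x * (phi x)%:C).

Fixpoint sobolev (k : nat) l f : Prop :=
  L2 l f /\
  if k is k'.+1 then exists2 g, is_weak_derivative l f g & sobolev k' l g
  else True.

(* f', for f in H^1(0, l): a representative, unique up to [aeeq l] *)
Definition weak_derivative l f : R -> R[i] :=
  xget (fun=> 0) [set g | L2 l g /\ is_weak_derivative l f g].

Definition is_continuous_rep l f (F : R -> R[i]) : Prop :=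
  [/\ {within `[0, l], continuous (fun x => complex.Re (F x))},
      {within `[0, l], continuous (fun x => complex.Im (F x))} &
      aeeq l F f].

(* The endpoints 0 and l are labelled by [false] and [true]. *)
Definition trace l f (b : bool) : R[i] :=
  xget 0 [set c | exists2 F, is_continuous_rep l f F &
                             F (if b then l else 0) = c].

End Interval.

(* The edge [e] is identified with [0, len e], the point 0 being located at
   [src e] and the point [len e] at [tgt e]. *)
Record metric_graph (R : realType) := MetricGraph {
  nvert : nat;
  edge : finType;
  src : edge -> 'I_nvert;
  tgt : edge -> 'I_nvert;
  len : edge -> R;
  edge_nonempty : (0 < #|edge|)%N;
  len_gt0 : forall e, 0 < len e
}.

Section Graph.
Context {R : realType} (G : metric_graph R).
Implicit Types (e : edge G) (v i j : 'I_(nvert G)) (p : edge G * bool).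

Definition joins e i j : bool :=
  ((src e == i) && (tgt e == j)) || ((src e == j) && (tgt e == i)).

Definition adjacent : rel 'I_(nvert G) := fun i j => [exists e, joins e i j].

Definition connected_graph : Prop := forall i j, connect adjacent i j.

(* vertex at which the edge endpoint [p] is located *)
Definition loc p : 'I_(nvert G) := if p.2 then tgt p.1 else src p.1.

Definition graph_fun := edge G -> R -> R[i].
Implicit Types (f g h : graph_fun).

Definition gaeeq f g : Prop := forall e, aeeq (len e) (f e) (g e).

Definition gL2 f : Prop := forall e, L2 (len e) (f e).

Definition inner f g : R[i] :=
  \sum_e cintegral (len e) (fun x => f e x * (g e x)^*).

Definition tildeH (k : nat) f : Prop := forall e, sobolev k (len e) (f e).

Definition gtrace f p : R[i] := trace (len p.1) (f p.1) p.2.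

Definition gderiv f : graph_fun := fun e => weak_derivative (len e) (f e).

Definition gH1 f : Prop :=
  tildeH 1 f /\ forall p p', loc p = loc p' -> gtrace f p = gtrace f p'.

(* f(v) for f in H^1(G), read off at any endpoint located at v; such an
   endpoint exists for every v when G is connected, as G has an edge *)
Definition vertex_value f v : R[i] :=
  if [pick p | loc p == v] is Some p then gtrace f p else 0.

(* derivatives are taken in the direction pointing towards v *)
Definition normal_derivative f v : R[i] :=
  \sum_(p | loc p == v)
    (if p.2 then gtrace (gderiv f) p else - gtrace (gderiv f) p).

Definition vertex_values f : 'cV[R[i]]_(nvert G) :=
  \col_v vertex_value f v.

Definition normal_derivatives f : 'cV[R[i]]_(nvert G) :=
  \col_v normal_derivative f v.

(* An operator in L^2(G) is represented by its graph, compatible with [gaeeq]. *)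

Definition operator := graph_fun -> graph_fun -> Prop.

Definition dom (T : operator) f : Prop := exists g, T f g.

Definition ker (T : operator) f : Prop := T f (fun _ _ => 0).

Definition adjoint (T : operator) : operator := fun g h =>
  [/\ gL2 g, gL2 h & forall f Tf, T f Tf -> inner Tf g = inner f h].

(* Krein-von Neumann extension of a closed, densely defined symmetric operator
   with positive lower bound: the restriction of its adjoint to
   dom T + ker T^* *)
Definition krein_von_neumann (T : operator) : operator := fun f g =>
  adjoint T f g /\
  exists f0 fs, [/\ dom T f0, ker (adjoint T) fs &
                    gaeeq f (fun e x => f0 e x + fs e x)].

(* [W], a linear subspace of L^2(G), has dimension [n] *)
Definition has_dimension (W : graph_fun -> Prop) (n : nat) : Prop :=
  exists b : 'I_n -> graph_fun,
    [/\ forall k, W (b k),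
        forall c : 'I_n -> R[i],
          gaeeq (fun e x => \sum_k c k * b k e x) (fun _ _ => 0) ->
          forall k, c k = 0 &
        forall f, W f -> exists c : 'I_n -> R[i],
          gaeeq f (fun e x => \sum_k c k * b k e x)].

Definition potential := edge G -> R -> R.
Implicit Type q : potential.

Definition schroedinger q f : graph_fun := fun e x =>
  - gderiv (gderiv f) e x + (q e x)%:C * f e x.

Definition S_op q : operator := fun f g =>
  [/\ tildeH 2 f, gH1 f,
      forall v, vertex_value f v = 0 /\ normal_derivative f v = 0,
      gL2 g & gaeeq g (schroedinger q f)].

Definition krein_laplacian q : operator := krein_von_neumann (S_op q).

Definition is_dtn q (M : 'M[R[i]]_(nvert G)) : Prop :=
  forall f, ker (adjoint (S_op q)) f ->
    normal_derivatives f = M *m vertex_values f.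

Definition dtn_matrix q : 'M[R[i]]_(nvert G) := xget 0 [set M | is_dtn q M].

Definition discrete_laplacian : 'M[R]_(nvert G) :=
  \matrix_(i, j)
    if i == j then
      \sum_(e | ((src e == i) || (tgt e == i)) && (src e != tgt e)) (len e)^-1
    else - \sum_(e | joins e i j) (len e)^-1.

End Graph.

(* Main.v *)
Require Import Defs.
From mathcomp Require Import all_boot all_order all_algebra.
From mathcomp Require Import complex.
From mathcomp Require Import all_classical all_reals all_analysis.
From mathcomp Require Import measurable_realfun ring lra.

(** Write [S] for the minimal operator. Everything rests on three facts.

    The adjoint. [S^*] acts as [-f'' + q f] on the functions that are in H^2 on
    each edge and continuous at the vertices ([adjoint_elim], [adjoint_intro]).
    If [g] is in the domain of [S^*], testing with the functions of H^2_0 on one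
    edge shows that [g] differs from a second primitive of [q g - S^* g] by an
    affine function ([weak_second_derivative]), so that [g] is in H^2; testing
    with functions that vanish at all the endpoints and have outward derivatives
    1 and -1 at two endpoints located at the same vertex, Green's identity
    ([graph_green]) shows that the values of [g] at these endpoints agree. The
    converse is Green's identity again.

    The kernel. The equation [f'' = q f] with prescribed values at both ends of an
    edge has exactly one solution. Existence is by Picard iteration, monotone
    because [q >= 0] ([initial_value_problem], [dirichlet_exists]); uniqueness is
    the energy identity ([dirichlet_unique]). Hence a member of the kernel of
    [S^*] is the same thing as an assignment of values to the vertices
    ([ker_exists], [ker_eq0]). This gives the dimension of the kernel, a basis
    dual to the vertices, and the existence and uniqueness of the
    Dirichlet-to-Neumann matrix, whose columns are the normal derivatives of the
    basis.

    The domain. By definition the Krein extension is the restriction of [S^*] to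
    the sum of the domain of [S] and the kernel of [S^*]. Members of the domain
    of [S] have zero vertex values and zero normal derivatives, so membership
    amounts to having the normal derivatives of the member of the kernel with the
    same vertex values ([dom_krein]). For [q = 0] the members of the kernel are
    affine on each edge, and their slopes assemble into the discrete Laplacian
    ([discrete_laplacian_dtn]).

    The potential is measurable and nonnegative up to null sets only; it is first
    replaced by a bounded nonnegative Borel function
    ([nonnegative_borel_representative]), which changes neither [S] nor its
    adjoint.

    On an interval, the weak derivatives and the traces are reduced to
    integrals: by the lemma of du Bois-Reymond ([du_bois_reymond]) the functions
    in H^1 are, up to equality almost everywhere, the primitives of
    square-summable functions ([primitive], [weak_derivative_primitive]), and for
    these integration by parts is a consequence of Fubini's theorem
    ([antideriv_by_parts]). *)

Set Implicit Arguments.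
Unset Strict Implicit.
Unset Printing Implicit Defensive.

Import Order.TTheory GRing.Theory Num.Theory numFieldNormedType.Exports.
Local Open Scope classical_set_scope.
Local Open Scope ring_scope.
Local Open Scope complex_scope.
(* reopened, for [x^*] to be the conjugation of numeric closed fields *)
Local Open Scope ring_scope.

(** * Integrals over ]0, x[ *)

Section RealInterval.
Context {R : realType}.
Notation mu := (@lebesgue_measure R).
Implicit Types (l x : R) (f g h : R -> R).

Definition summable_on l f : Prop := mu.-integrable `]0, l[ (EFin \o f).

Definition antideriv f x : R := Rintegral mu `]0, x[ f.

Definition square_summable l f : Prop :=
  measurable_fun `]0, l[ f /\ summable_on l (fun x => f x ^+ 2).

Lemma ae_sub (P Q : R -> Prop) : (forall x, P x -> Q x) ->
  (\forall x \ae mu, P x) -> \forall x \ae mu, Q x.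
Proof.
by move=> PQ; apply: filterS => //; exact: (ae_filter_ringOfSetsType mu).
Qed.

Lemma ae_and (P Q : R -> Prop) : (\forall x \ae mu, P x) ->
  (\forall x \ae mu, Q x) -> \forall x \ae mu, P x /\ Q x.
Proof.
by move=> aP aQ; apply: filterI => //; exact: (ae_filter_ringOfSetsType mu).
Qed.

Lemma summable_on_measurable l f : summable_on l f -> measurable_fun `]0, l[ f.
Proof. by move=> /(measurable_int mu) /measurable_EFinP. Qed.

Lemma summable_le l f g : measurable_fun `]0, l[ f -> summable_on l g ->
  (forall x, x \in `]0, l[ -> `|f x| <= g x) -> summable_on l f.
Proof.
move=> mf ig fg; apply: le_integrable ig => //; first exact/measurable_EFinP.
by move=> x xl /=; rewrite lee_fin (le_trans (fg _ xl))// ler_norm.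
Qed.

Lemma summable_cst l (c : R) : summable_on l (fun=> c).
Proof.
apply/integrableP; split; first exact/measurable_EFinP.
rewrite /= integral_cst//=; apply: lte_mul_pinfty => //.
rewrite lebesgue_measure_itv/= lte_fin; case: ifP => _; last exact: ltry.
by rewrite -EFinD ltry.
Qed.

Lemma summableD l f g : summable_on l f -> summable_on l g ->
  summable_on l (fun x => f x + g x).
Proof. by move=> fi gi; exact: (@integrableD _ _ _ mu _ _ (EFin \o f) (EFin \o g)). Qed.

Lemma summableZ l (c : R) f : summable_on l f -> summable_on l (fun x => c * f x).
Proof. by move=> fi; exact: (@integrableZl _ _ _ mu _ _ c (EFin \o f)). Qed.

Lemma summableB l f g : summable_on l f -> summable_on l g ->
  summable_on l (fun x => f x - g x).
Proof. by move=> fi gi; exact: (@integrableB _ _ _ mu _ _ (EFin \o f) (EFin \o g)). Qed.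

Lemma subset_oo0 l x : x <= l -> `]0, x[ `<=` (`]0, l[ : set R).
Proof. by move=> xl; apply: subset_itvl; rewrite bnd_simp. Qed.

Lemma summableS l x f : x <= l -> summable_on l f -> summable_on x f.
Proof. by move=> xl; apply: integrableS => //; exact: subset_oo0. Qed.

Lemma summable_bounded l (M : R) f : measurable_fun `]0, l[ f ->
  (forall x, x \in `]0, l[ -> `|f x| <= M) -> summable_on l f.
Proof. by move=> mf fM; exact: summable_le (summable_cst l M) fM. Qed.

Lemma summableM_bounded l (M : R) f g : summable_on l f ->
  measurable_fun `]0, l[ g -> (forall x, x \in `]0, l[ -> `|g x| <= M) ->
  summable_on l (fun x => f x * g x).
Proof.
move=> fi mg gM; apply: (@summable_le _ _ (fun x => M * `|f x|)).
- by apply: measurable_funM => //; exact: summable_on_measurable.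
- by apply: summableZ; exact: integrable_norm.
- by move=> x xl; rewrite normrM mulrC ler_wpM2r// gM.
Qed.

Lemma antideriv_aeeq l f g : measurable_fun `]0, l[ f ->
  measurable_fun `]0, l[ g -> aeeq l f g -> antideriv f l = antideriv g l.
Proof.
move=> mf mg fg; rewrite /antideriv /Rintegral; congr fine.
apply: ae_eq_integral => //; [exact/measurable_EFinP|exact/measurable_EFinP|].
by apply: ae_sub fg => x fg xl /=; rewrite fg.
Qed.

Lemma eq_antideriv l f g : (forall x, x \in `]0, l[ -> f x = g x) ->
  antideriv f l = antideriv g l.
Proof.
move=> fg; apply: eq_Rintegral => x; rewrite inE => xl.
by apply: fg; rewrite inE.
Qed.

Lemma antiderivD l f g : summable_on l f -> summable_on l g ->
  antideriv (fun x => f x + g x) l = antideriv f l + antideriv g l.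
Proof. by move=> fi gi; exact: RintegralD. Qed.

Lemma antiderivB l f g : summable_on l f -> summable_on l g ->
  antideriv (fun x => f x - g x) l = antideriv f l - antideriv g l.
Proof. by move=> fi gi; exact: RintegralB. Qed.

Lemma antiderivZ l (c : R) f : summable_on l f ->
  antideriv (fun x => c * f x) l = c * antideriv f l.
Proof. by move=> fi; exact: RintegralZl. Qed.

Lemma antiderivN l f : summable_on l f ->
  antideriv (fun x => - f x) l = - antideriv f l.
Proof.
move=> fi; rewrite -mulN1r -antiderivZ//.
by apply: eq_antideriv => x _; rewrite mulN1r.
Qed.

Lemma antideriv_cst l (c : R) : 0 <= l -> antideriv (fun=> c) l = c * l.
Proof.
move=> l0; rewrite /antideriv Rintegral_cst//=.
rewrite lebesgue_measure_itv/= lte_fin.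
by case: ltrP => [|l0']/=; rewrite ?subr0//; have -> : l = 0 by exact/le_anti/andP.
Qed.

Lemma antideriv_le0 f x : x <= 0 -> antideriv f x = 0.
Proof.
by move=> x0; rewrite /antideriv set_itv_ge ?Rintegral_set0// bnd_simp -leNgt.
Qed.

Lemma antideriv0 f : antideriv f 0 = 0.
Proof. exact: antideriv_le0. Qed.

Lemma antideriv_ge0 f x : (forall y, y \in `]0, x[ -> 0 <= f y) ->
  0 <= antideriv f x.
Proof. by move=> f0; apply: Rintegral_ge0 => y yx; exact: f0. Qed.

Lemma le_antideriv l f g : summable_on l f -> summable_on l g ->
  (forall x, x \in `]0, l[ -> f x <= g x) -> antideriv f l <= antideriv g l.
Proof. by move=> fi gi fg; apply: le_Rintegral => // x xl; exact: fg. Qed.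

Lemma antideriv_norm_le l f : summable_on l f ->
  `|antideriv f l| <= antideriv (fun x => `|f x|) l.
Proof. by move=> fi; exact: le_normr_Rintegral. Qed.

Lemma le_antideriv_ge0 l x f : x <= l -> summable_on l f ->
  (forall y, y \in `]0, l[ -> 0 <= f y) -> antideriv f x <= antideriv f l.
Proof.
move=> xl fi f0; rewrite /antideriv /Rintegral fine_le//.
- by apply: integrable_fin_num => //; exact: (summableS xl).
- exact: integrable_fin_num.
- apply: ge0_subset_integral => //.
  + by have /(measurable_int mu) := fi.
  + exact: subset_oo0.
Qed.

Lemma antideriv_bounded l f : summable_on l f ->
  exists M, forall x, x <= l -> `|antideriv f x| <= M.
Proof.
move=> fi; exists (antideriv (fun y => `|f y|) l) => x xl.
apply: (le_trans (antideriv_norm_le (summableS xl fi))).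
by apply: le_antideriv_ge0 => //; exact: integrable_norm.
Qed.

Lemma antideriv_continuous l f : 0 <= l -> summable_on l f ->
  {within `[0, l], continuous (antideriv f)}.
Proof.
move=> l0 fi.
have fi' : mu.-integrable `[0, l] (EFin \o (f \_ `]0, l[)).
  by rewrite -restrict_EFin; apply/integrable_restrict => //=; rewrite setIidr//;
    exact: subset_itv_oo_cc.
have := parameterized_integral_continuous l0 fi'.
apply: (@subspace_eq_continuous).
move=> x; rewrite inE/= in_itv/= => /andP[x0 xl].
rewrite /from_subspace /parameterized_integral /antideriv.
rewrite -Rintegral_itv_bndo_bndc; last first.
  by apply: integrableS fi' => //; apply: subset_itvl; rewrite bnd_simp.
rewrite -Rintegral_itv_obnd_cbnd; last first.
  by apply: integrableS fi' => //; apply: subset_itvScc; rewrite bnd_simp.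
apply: eq_Rintegral => y; rewrite inE => yx.
by rewrite patchE mem_set//; exact: subset_oo0 yx.
Qed.

Lemma cont_itv_measurable l f : {within `[0, l], continuous f} ->
  measurable_fun `]0, l[ f.
Proof.
move=> cf; apply: (@measurable_funS _ _ _ _ `[0, l]) => //.
  exact: subset_itv_oo_cc.
exact: subspace_continuous_measurable_fun.
Qed.

Lemma cont_itv_bounded l f : {within `[0, l], continuous f} ->
  exists M, forall x, x \in `[0, l] -> `|f x| <= M.
Proof.
move=> cf.
have /compact_bounded[M [_ fM]] : compact (f @` `[0, l]).
  by apply: continuous_compact => //; exact: segment_compact.
exists (M + 1) => x xl; apply: (fM (M + 1)); first by rewrite ltrDl.
by apply: imageP; exact: xl.
Qed.

Lemma antideriv_measurable l f : summable_on l f ->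
  measurable_fun `]0, l[ (antideriv f).
Proof.
case: (leP 0 l) => l0 fi.
  by apply: cont_itv_measurable; exact: antideriv_continuous.
rewrite set_itv_ge; last by rewrite bnd_simp -leNgt ltW.
exact: measurable_fun_set0.
Qed.

(** The function [f x * g t] is integrated over the triangle [t < x] in both
    orders. *)
Lemma antideriv_fubini l f g : summable_on l f -> summable_on l g ->
  antideriv (fun x => f x * antideriv g x) l =
  antideriv (fun t => g t * (antideriv f l - antideriv f t)) l.
Proof.
move=> fi gi.
pose fr := f \_ `]0, l[; pose gr := g \_ `]0, l[.
have fri : mu.-integrable setT (EFin \o fr).
  by rewrite -restrict_EFin; apply/integrable_restrict; rewrite ?setTI.
have gri : mu.-integrable setT (EFin \o gr).
  by rewrite -restrict_EFin; apply/integrable_restrict; rewrite ?setTI.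
have mfr : measurable_fun setT fr.
  by apply/measurable_EFinP; exact: (measurable_int mu).
have mgr : measurable_fun setT gr.
  by apply/measurable_EFinP; exact: (measurable_int mu).
pose k (z : R * R) := if z.2 < z.1 then fr z.1 * gr z.2 else 0.
have mk : measurable_fun setT k.
  apply: measurable_fun_ifT => //.
  - exact: (measurable_fun_ltr measurable_snd measurable_fst).
  - by apply: measurable_funM; exact: measurableT_comp.
have kE1 x : x \in `]0, l[ ->
    (fun t => k (x, t)) = (fun t => fr x * (g \_ `]0, x[) t).
  move=> xl; apply/funext => t; rewrite /k /gr !patchE /= !mem_setE.
  move: xl; rewrite !in_itv/= => /andP[x0 xl].
  case: ifPn => tx; rewrite ?andbT ?andbF ?mulr0//.
  by rewrite (lt_trans tx xl) andbT.
have kE2 t : t \in `]0, l[ ->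
    (fun x => k (x, t)) = (fun x => gr t * (f \_ `]t, l[) x).
  move=> tl; apply/funext => x; rewrite /k /fr !patchE /= !mem_setE.
  move: tl; rewrite !in_itv/= => /andP[t0 tl].
  case: ifPn => tx; rewrite ?andbT ?andbF ?mulr0//.
  by rewrite (lt_trans t0 tx) /= mulrC.
have int1 x : (\int[mu]_t (k (x, t))%:E = (fr x * antideriv g x)%:E)%E.
  have [xl|xl] := boolP (x \in `]0, l[); last first.
    rewrite /fr patchE mem_setE (negPf xl) mul0r.
    under eq_integral => t _.
      rewrite /k /fr /= patchE mem_setE (negPf xl) mul0r.
      rewrite (_ : (if _ then _ else _) = 0); last by case: ifP.
      over.
    by rewrite integral0.
  have gx : mu.-integrable setT (EFin \o (g \_ `]0, x[)).
    rewrite -restrict_EFin; apply/integrable_restrict; rewrite ?setTI//.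
    by apply: (@summableS l) => //; move: xl; rewrite in_itv/= => /andP[_ /ltW].
  rewrite (_ : (fun t => (k (x, t))%:E) =
    (fun t => (fr x)%:E * ((g \_ `]0, x[) t)%:E)%E); last first.
    by apply/funext => t; rewrite -EFinM -(congr1 (@^~ t) (kE1 x xl)).
  rewrite integralZl// EFinM; congr (_ * _)%E.
  rewrite /antideriv Rintegral_mkcond /Rintegral fineK//.
  exact: integrable_fin_num.
have int2 t : (\int[mu]_x (k (x, t))%:E =
    (gr t * (antideriv f l - antideriv f t))%:E)%E.
  have [tl|tl] := boolP (t \in `]0, l[); last first.
    rewrite /gr patchE mem_setE (negPf tl) mul0r.
    under eq_integral => x _.
      rewrite /k /gr /= patchE mem_setE (negPf tl) mulr0.
      rewrite (_ : (if _ then _ else _) = 0); last by case: ifP.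
      over.
    by rewrite integral0.
  have [t0 tl'] : 0 < t /\ t < l by move: tl; rewrite in_itv/= => /andP.
  have fx : mu.-integrable setT (EFin \o (f \_ `]t, l[)).
    rewrite -restrict_EFin; apply/integrable_restrict; rewrite ?setTI//.
    by apply: integrableS fi => //; apply: subset_itvr; rewrite bnd_simp ltW.
  rewrite (_ : (fun x => (k (x, t))%:E) =
    (fun x => (gr t)%:E * ((f \_ `]t, l[) x)%:E)%E); last first.
    by apply/funext => x; rewrite -EFinM -(congr1 (@^~ x) (kE2 t tl)).
  rewrite integralZl// EFinM; congr (_ * _)%E.
  rewrite /antideriv (@Rintegral_itv_bndo_bndc _ _ t); last first.
    by apply: summableS fi; exact: ltW.
  rewrite Rintegral_itvB ?bnd_simp//; last exact: ltW.
  rewrite Rintegral_mkcond /Rintegral fineK//.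
  exact: integrable_fin_num.
have ki : (mu \x mu)%E.-integrable setT (EFin \o k).
  apply/integrable12ltyP; first exact/measurable_EFinP.
  pose C := (\int[mu]_t `|(gr t)%:E|)%E.
  have Cfin : C \is a fin_num.
    by apply: integrable_fin_num => //; exact: integrable_abse gri.
  have C0 : (0 <= C)%E by apply: integral_ge0.
  apply: (@le_lt_trans _ _ (\int[mu]_x (`|(fr x)%:E| * C))%E).
    apply: ge0_le_integral => //.
    - by move=> x _; exact: integral_ge0.
    - apply: (@measurable_fun_fubini_tonelli_F _ _ _ _ _ mu
        (fun z : R * R => `|(k z)%:E|)%E) => //.
      by apply: measurableT_comp => //; exact/measurable_EFinP.
    - apply: emeasurable_funM => //.
      by apply: measurableT_comp => //; exact/measurable_EFinP.
    - move=> x _; rewrite -ge0_integralZl//; last first.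
        by apply: measurableT_comp => //; exact/measurable_EFinP.
      apply: ge0_le_integral => //.
      - apply: measurableT_comp => //; apply/measurable_EFinP.
        exact: (measurableT_comp mk (pair1_measurable x)).
      - apply: measurable_funeM.
        by apply: measurableT_comp => //; exact/measurable_EFinP.
      - move=> t _; rewrite -abseM -EFinM /k /=; case: ifP => // _.
        by rewrite lee_fin normr0 normr_ge0.
  rewrite -(fineK Cfin) integralZr//; last exact: integrable_abse fri.
  have := integrable_fin_num measurableT (integrable_abse fri).
  by move=> /fineK <-; rewrite -EFinM ltry.
have FE : (\int[mu]_x (fr x * antideriv g x)%:E =
           \int[mu]_t (gr t * (antideriv f l - antideriv f t))%:E)%E.
  have <- : (fun x => \int[mu]_t (k (x, t))%:E)%E =
      (fun x => (fr x * antideriv g x)%:E) by exact/funext.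
  have <- : (fun t => \int[mu]_x (k (x, t))%:E)%E =
      (fun t => (gr t * (antideriv f l - antideriv f t))%:E) by exact/funext.
  exact: Fubini ki.
rewrite [LHS]/antideriv [RHS]/antideriv [LHS]Rintegral_mkcond.
rewrite [RHS]Rintegral_mkcond /Rintegral; congr fine.
transitivity (\int[mu]_x (fr x * antideriv g x)%:E)%E; last first.
  rewrite FE; apply: eq_integral => t _; rewrite /gr !patchE.
  by case: ifP => _; rewrite ?mul0r.
apply: eq_integral => t _; rewrite /fr !patchE.
by case: ifP => _; rewrite ?mul0r.
Qed.

(** The antiderivatives are differentiable only almost everywhere, so that the
    product rule is not at hand; the formula is Fubini's theorem on the square,
    cut along its diagonal. *)
Lemma antideriv_by_parts l f g : summable_on l f -> summable_on l g ->
  antideriv (fun x => f x * antideriv g x + antideriv f x * g x) l =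
  antideriv f l * antideriv g l.
Proof.
move=> fi gi; have [Mg gM] := antideriv_bounded gi.
have [Mf fM] := antideriv_bounded fi.
have fGi : summable_on l (fun x => f x * antideriv g x).
  apply: (@summableM_bounded _ Mg) => //; first exact: antideriv_measurable.
  by move=> x; rewrite in_itv/= => /andP[_ /ltW]; exact: gM.
have gFi : summable_on l (fun x => g x * antideriv f x).
  apply: (@summableM_bounded _ Mf) => //; first exact: antideriv_measurable.
  by move=> x; rewrite in_itv/= => /andP[_ /ltW]; exact: fM.
under eq_antideriv do rewrite (mulrC (antideriv f _)).
rewrite antiderivD// antideriv_fubini//.
under eq_antideriv do rewrite mulrBr (mulrC _ (antideriv f l)).
by rewrite antiderivB ?antiderivZ//; [rewrite subrK|exact: summableZ].
Qed.

End RealInterval.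

(** * The lemma of du Bois-Reymond *)

Section DuBoisReymond.
Context {R : realType}.
Notation mu := (@lebesgue_measure R).
Implicit Types (l x : R) (f g h w : R -> R).

Lemma antideriv_dct l (F : nat -> R -> R) f g :
  (forall n, measurable_fun `]0, l[ (F n)) -> summable_on l g ->
  (forall n x, x \in `]0, l[ -> `|F n x| <= g x) ->
  (forall x, x \in `]0, l[ -> F n x @[n --> \oo] --> f x) ->
  summable_on l f /\ antideriv (F n) l @[n --> \oo] --> antideriv f l.
Proof.
move=> mF ig Fg Ff.
have mf : measurable_fun `]0, l[ f.
  by apply: (measurable_fun_cvg mF) => x xl; exact: Ff.
have [] := @dominated_convergence _ _ _ mu `]0, l[%classic _
  (fun n => EFin \o F n) (EFin \o f) (EFin \o g) _ _ _ ig.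
- by [].
- by move=> n; apply/measurable_EFinP; exact: mF.
- exact/measurable_EFinP.
- apply: aeW => x xl; apply: cvg_EFin; first exact: nearW.
  exact: Ff.
- by apply: aeW => x n xl /=; rewrite lee_fin; exact: Fg.
move=> fi _ cF; split => //.
rewrite /antideriv /Rintegral.
apply: fine_cvg; rewrite fineK//; exact: integrable_fin_num.
Qed.

(** By Lebesgue's differentiation theorem [f] is almost everywhere the derivative
    of its antiderivative. *)
Lemma antideriv_eq0_ae l f : summable_on l f ->
  (forall x, x \in `[0, l] -> antideriv f x = 0) -> aeeq l f (fun=> 0).
Proof.
move=> fi f0; pose fr := f \_ `]0, l[.
have fri : mu.-integrable setT (EFin \o fr).
  by rewrite -restrict_EFin; apply/integrable_restrict; rewrite ?setTI.
pose F y : R := Rintegral mu `]0, y] fr.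
have F0 : F = fun=> 0.
  apply/funext => y; rewrite /F -Rintegral_mkcondr.
  have [yl|ly] := ltP y l.
    rewrite setIidl; last by apply: subset_itvl; rewrite bnd_simp.
    have [y0|y0] := leP y 0.
      by rewrite set_itv_ge ?Rintegral_set0// bnd_simp -leNgt.
    rewrite -Rintegral_itv_bndo_bndc; last exact: (summableS (ltW yl) fi).
    by apply: f0; rewrite in_itv/= !ltW.
  rewrite setIidr; last by apply: subset_itvl; rewrite bnd_simp.
  have [l0|l0] := leP l 0; first exact: antideriv_le0.
  by apply: f0; rewrite in_itv/= lexx ltW.
have fry y : mu.-integrable `]0, y] (EFin \o fr) by apply: integrableS fri.
have frl : locally_integrable setT fr.
  by apply: open_integrable_locally => //; exact: openT.
have := FTC1 fry frl; rewrite -/F F0; apply: ae_sub => x fx xl.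
have [|_] := fx; first by rewrite lte_fin; move: xl; rewrite in_itv/= => /andP[].
by rewrite derive1_cst /fr patchE mem_set.
Qed.

(** The primitive of [w] starting at minus infinity vanishes on the left of the
    support of [w], and on its right because the mean of [w] is zero. *)
Lemma zero_mean_test l a b w : 0 < l -> continuous w -> 0 < a -> b < l ->
  (forall x, x \notin `[a, b] -> w x = 0) -> antideriv w l = 0 ->
  exists2 phi, test_fun l phi & derive1 phi = w.
Proof.
move=> l0 cw a0 bl w0 wl0.
have wE : w = w \_ `]0, l[.
  apply/funext => x; rewrite patchE; case: ifPn => //.
  rewrite mem_setE => xl; apply: w0; apply: contra xl.
  rewrite !in_itv/= => /andP[ax xb].
  by rewrite (lt_le_trans a0 ax) (le_lt_trans xb bl).
have mw : measurable_fun setT w by exact: continuous_measurable_fun.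
have wl : summable_on l w.
  have [|M wM] := @cont_itv_bounded _ l w; first exact: continuous_subspaceT.
  apply: (@summable_bounded _ _ M); first exact: measurable_funS mw.
  by move=> x xl; apply: wM; exact: subset_itv_oo_cc xl.
have wi : mu.-integrable setT (EFin \o w).
  by rewrite wE -restrict_EFin; apply/integrable_restrict; rewrite ?setTI.
pose phi x := Rintegral mu `]-oo, x] w.
have dphi x : derivable phi x 1 /\ derive1 phi x = w x.
  apply: (@continuous_FTC1 _ w -oo%O x (x + 1)) => //.
  - by rewrite ltrDl.
  - by apply: integrableS wi.
  - exact: ltNyr.
  - exact: cw.
have phiE : derive1 phi = w by apply/funext => x; exact: (dphi x).2.
exists phi => //; split => [x||]; first exact: (dphi x).1.
  by rewrite phiE.
exists a, b; split => // x; rewrite in_itv/= negb_and -!ltNge => /orP[xa|bx].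
  rewrite /phi (@eq_Rintegral _ _ _ _ _ (fun=> 0)).
    by rewrite /Rintegral integral0.
  move=> y; rewrite inE/= in_itv/= => yx; apply: w0.
  by rewrite in_itv/= leNgt (le_lt_trans yx xa).
rewrite /phi Rintegral_mkcond (_ : w \_ _ = w).
  by rewrite wE -Rintegral_mkcond.
apply/funext => y; rewrite patchE; case: ifPn => //.
rewrite mem_setE in_itv/= -ltNge => xy; apply/esym/w0.
by rewrite in_itv/= negb_and -!ltNge (lt_trans bx xy) orbT.
Qed.

Let eps n : R := n.+1%:R^-1.

(* [bump b n] is continuous, vanishes outside [eps n, b - eps n] and tends to the
   indicator of ]0, b[ as [n] grows *)
Let ramp (t : R) : R := t + `|t|.
Let spread (b : R) n x : R := ramp (x - eps n) * ramp (b - eps n - x).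
Let bump (b : R) n x : R := spread b n x / (spread b n x + eps n).

Let eps_gt0 n : 0 < eps n. Proof. by rewrite invr_gt0. Qed.

Let ramp_ge0 t : 0 <= ramp t.
Proof. by rewrite /ramp -lerBlDl sub0r -normrN ler_norm. Qed.

Let ramp_neg t : t <= 0 -> ramp t = 0.
Proof. by move=> t0; rewrite /ramp ler0_norm// subrr. Qed.

Let ramp_pos t : 0 < t -> 0 < ramp t.
Proof. by move=> t0; rewrite /ramp gtr0_norm// addr_gt0. Qed.

Let ramp_cvg (T : Type) (F : set_system T) {FF : Filter F} (f : T -> R) a :
  f t @[t --> F] --> a -> ramp (f t) @[t --> F] --> ramp a.
Proof. by move=> fa; apply: cvgD => //; exact: cvg_norm. Qed.

Let spread_ge0 b n x : 0 <= spread b n x. Proof. exact: mulr_ge0. Qed.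

Let spreadD_gt0 b n x : 0 < spread b n x + eps n.
Proof. exact: ltr_wpDl. Qed.

Let bump_continuous b n : continuous (bump b n).
Proof.
have cs : continuous (spread b n).
  move=> x; apply: cvgM.
    by apply: ramp_cvg; apply: cvgB; [exact: cvg_id|exact: cvg_cst].
  by apply: ramp_cvg; apply: cvgB; [exact: cvg_cst|exact: cvg_id].
move=> x; apply: cvgM; first exact: cs.
apply: cvgV; first by rewrite gt_eqF.
by apply: cvgD; [exact: cs|exact: cvg_cst].
Qed.

Let bump_le1 b n x : `|bump b n x| <= 1.
Proof.
rewrite ger0_norm ?divr_ge0//; last exact: ltW.
by rewrite ler_pdivrMr// mul1r lerDl ltW.
Qed.

Let bump_out b l n N x : b <= l -> (n <= N)%N ->
  x \notin `[eps N, l - eps N] -> bump b n x = 0.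
Proof.
move=> bl nN; rewrite in_itv/= negb_and -!ltNge => xN.
have eN : eps N <= eps n by rewrite /eps lef_pV2 ?posrE// ler_nat ltnS.
rewrite /bump (_ : spread b n x = 0) ?mul0r//.
case/orP: xN => xN; rewrite /spread.
  by rewrite ramp_neg ?mul0r// subr_le0 (le_trans (ltW xN)).
rewrite mulrC ramp_neg ?mul0r// subr_le0 (le_trans _ (ltW xN))//.
by rewrite lerB.
Qed.

Let bump_cvg b x : x \in `]0, b[ -> bump b n x @[n --> \oo] --> (1 : R).
Proof.
rewrite in_itv/= => /andP[x0 xb].
pose s := ramp x * ramp (b - x).
have s0 : 0 < s by rewrite mulr_gt0// ramp_pos// subr_gt0.
have e0 : eps n @[n --> \oo] --> (0 : R) by exact: cvg_harmonic.
have cs : spread b n x @[n --> \oo] --> s.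
  apply: cvgM.
    by apply: ramp_cvg; rewrite -[X in _ --> X]subr0; apply: cvgB => //; exact: cvg_cst.
  apply: ramp_cvg; apply: cvgB; last exact: cvg_cst.
  by rewrite -[X in _ --> X]subr0; apply: cvgB => //; exact: cvg_cst.
rewrite -(@divff _ s) ?gt_eqF// -{2}[s]addr0; apply: cvgM => //.
by apply: cvgV; [rewrite addr0 gt_eqF|exact: cvgD].
Qed.

Let bump_measurable l b n : measurable_fun `]0, l[ (bump b n).
Proof.
apply: measurable_funS (continuous_measurable_fun (@bump_continuous b n)) => //.
Qed.

(** Every continuous compactly supported function of mean zero is the derivative
    of a test function. Applied to a bump minus the multiple of a fixed bump that
    makes the mean zero, this shows that [u - k] is orthogonal to all bumps, for a
    suitable constant [k]; bumps tending to indicators of intervals then give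
    that all the integrals of [u - k] over ]0, b[ vanish. *)
Lemma du_bois_reymond l u : 0 < l -> summable_on l u ->
  (forall phi, test_fun l phi -> antideriv (fun x => u x * derive1 phi x) l = 0) ->
  exists k : R, aeeq l u (fun=> k).
Proof.
move=> l0 ui u0.
have bumpi b n : summable_on l (bump b n).
  by apply: (@summable_bounded _ _ 1).
have ubumpi v b n : summable_on l v -> summable_on l (fun x => v x * bump b n x).
  by move=> vi; apply: (@summableM_bounded _ _ 1).
have [n0 c0] : exists n, antideriv (bump l n) l != 0.
  have [|||_] := @antideriv_dct l (bump l) (fun=> 1) (fun=> 1) _ (summable_cst l 1).
  - by move=> n; exact: bump_measurable.
  - by [].
  - exact: bump_cvg.
  rewrite antideriv_cst ?ltW// mul1r => cl.
  apply/not_existsP => /= b0; move/negP: (lt_irreflexive l); apply.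
  suff : l = 0 by move=> l00; rewrite {1}l00.
  apply: (cvg_unique _ cl) => //=.
  rewrite (_ : (fun n => _) = fun=> 0); first exact: cvg_cst.
  by apply/funext => n; have := b0 n; move/negP; rewrite negbK => /eqP.
pose k := antideriv (fun x => u x * bump l n0 x) l / antideriv (bump l n0) l.
have uk b n : b <= l ->
    antideriv (fun x => (u x - k) * bump b n x) l = 0.
  move=> bl; pose c := antideriv (bump b n) l / antideriv (bump l n0) l.
  pose w x := bump b n x - c * bump l n0 x.
  have cw : continuous w.
    move=> x; apply: cvgB; first exact: bump_continuous.
    by apply: cvgM; [exact: cvg_cst|exact: bump_continuous].
  (* a common support for the two bumps, compact in ]0, l[ *)
  pose N := maxn n n0.
  have [||||phi tphi phiE] := @zero_mean_test l (eps N) (l - eps N) w l0 cw.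
  - by [].
  - by rewrite ltrBlDr ltrDl.
  - move=> x xN; rewrite /w (bump_out bl _ xN) ?leq_maxl//.
    by rewrite (bump_out _ _ xN) ?leq_maxr// mulr0 subr0.
  - by rewrite /w antiderivB ?antiderivZ ?divfK ?subrr//; exact: summableZ.
  have := u0 _ tphi; rewrite phiE.
  under eq_antideriv do rewrite /w mulrBr (mulrCA _ c).
  rewrite antiderivB ?antiderivZ;
    [|exact: ubumpi|exact: ubumpi|by apply: summableZ; exact: ubumpi].
  move=> uw; under eq_antideriv do rewrite mulrBl.
  rewrite antiderivB ?antiderivZ; [|exact: bumpi|exact: ubumpi|exact: summableZ].
  rewrite -[RHS]uw; congr (_ - _).
  by rewrite /k /c mulrAC [RHS]mulrAC (mulrC (antideriv (bump b n) l)).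
exists k.
have uki : summable_on l (fun x => u x - k).
  by apply: summableB => //; exact: summable_cst.
suff : aeeq l (fun x => u x - k) (fun=> 0).
  by apply: ae_sub => x + xl => /(_ xl)/eqP; rewrite subr_eq0 => /eqP.
apply: antideriv_eq0_ae => // b; rewrite in_itv/= => /andP[b0 bl].
have [||||_ cb] := @antideriv_dct b (fun n x => (u x - k) * bump b n x)
    (fun x => u x - k) (fun x => `|u x - k|).
- by move=> n; apply: summable_on_measurable; apply: (summableS bl); exact: ubumpi.
- by apply: (summableS bl); exact: integrable_norm.
- by move=> n x _; rewrite normrM ler_piMr.
- move=> x xb; rewrite -[X in _ --> X]mulr1; apply: cvgM; first exact: cvg_cst.
  exact: bump_cvg.
apply: (cvg_unique _ cb) => //=.
rewrite (_ : (fun n => _) = fun=> 0); first exact: cvg_cst.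
apply/funext => n; rewrite -(uk b n bl).
rewrite /antideriv [LHS]Rintegral_mkcond [RHS]Rintegral_mkcond.
apply: eq_Rintegral => x _; rewrite !patchE !mem_setE !in_itv/=.
case: ifPn => [/andP[-> xb]|xb]; first by rewrite (lt_le_trans xb bl).
case: ifPn => // /andP[x0 xl]; rewrite (@bump_out b b n n)// ?mulr0//.
apply: contra xb; rewrite in_itv/= => /andP[nx xn]; rewrite x0 /=.
by rewrite (le_lt_trans xn)// ltrBlDr ltrDl.
Qed.

End DuBoisReymond.

(** * Square-summable functions *)

Section ComplexInterval.
Context {R : realType}.
Notation mu := (@lebesgue_measure R).
Notation Re := complex.Re.
Notation Im := complex.Im.
Implicit Types (l : R) (u v : R -> R) (f g h F G : R -> R[i]).

Lemma ReD (x y : R[i]) : Re (x + y) = Re x + Re y.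
Proof. by case: x; case: y. Qed.
Lemma ImD (x y : R[i]) : Im (x + y) = Im x + Im y.
Proof. by case: x; case: y. Qed.
Lemma ReN (x : R[i]) : Re (- x) = - Re x.
Proof. by case: x. Qed.
Lemma ReM (x y : R[i]) : Re (x * y) = Re x * Re y - Im x * Im y.
Proof. by case: x; case: y. Qed.
Lemma ImM (x y : R[i]) : Im (x * y) = Re x * Im y + Im x * Re y.
Proof. by case: x => a b; case: y => c d /=; rewrite (mulrC b). Qed.
Lemma ReJ (x : R[i]) : Re (x^*) = Re x. Proof. by case: x. Qed.
Lemma ImJ (x : R[i]) : Im (x^*) = - Im x. Proof. by case: x. Qed.
Lemma complexP (x y : R[i]) : Re x = Re y -> Im x = Im y -> x = y.
Proof. by case: x => a b; case: y => c d /= -> ->. Qed.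
Lemma ReC (a : R) : Re a%:C = a. Proof. by []. Qed.
Lemma ImC (a : R) : Im a%:C = 0. Proof. by []. Qed.

Definition ReE := (ReD, ReN, ReM, ReJ, ReC, ImC).

Lemma conjD (x y : R[i]) : (x + y)^* = x^* + y^*.
Proof. exact: rmorphD. Qed.
Lemma conjN (x : R[i]) : (- x)^* = - x^*.
Proof. exact: rmorphN. Qed.
Lemma conjM (x y : R[i]) : (x * y)^* = x^* * y^*.
Proof. exact: rmorphM. Qed.
Lemma conj_real (a : R) : (a%:C)^* = a%:C.
Proof. exact: conjc_real. Qed.

Lemma eq_summable l u v : (forall x, x \in `]0, l[ -> u x = v x) ->
  summable_on l u -> summable_on l v.
Proof.
move=> uv; apply: eq_integrable => // x; rewrite inE => xl /=.
by rewrite uv.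
Qed.

Lemma eq_measurable_oo l u v : (forall x, x \in `]0, l[ -> u x = v x) ->
  measurable_fun `]0, l[ u -> measurable_fun `]0, l[ v.
Proof. by move=> uv; apply: eq_measurable_fun => x; rewrite inE; exact: uv. Qed.

Lemma sqs_product l u v : square_summable l u -> square_summable l v ->
  summable_on l (fun x => u x * v x).
Proof.
move=> [mu2 u2] [mv v2].
apply: (@summable_le _ _ _ (fun x => u x ^+ 2 + v x ^+ 2)).
- exact: measurable_funM.
- exact: summableD.
- move=> x _; rewrite normrM -(real_normK (num_real (u x))).
  rewrite -(real_normK (num_real (v x))).
  have := sqr_ge0 (`|u x| - `|v x|); have := normr_ge0 (u x).
  by have := normr_ge0 (v x); nra.
Qed.

Lemma sqs_bounded l (M : R) u : measurable_fun `]0, l[ u ->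
  (forall x, x \in `]0, l[ -> `|u x| <= M) -> square_summable l u.
Proof.
move=> mu_ uM; split=> //.
apply: (@summable_bounded _ _ (M ^+ 2)); first exact: measurable_funX.
move=> x xl; rewrite normrX; apply: lerXn2r; rewrite ?nnegrE ?uM//.
by rewrite (le_trans _ (uM _ xl)).
Qed.

Lemma sqs_cst l (c : R) : square_summable l (fun=> c).
Proof. exact: (@sqs_bounded _ `|c|). Qed.

Lemma sqs_summable l u : square_summable l u -> summable_on l u.
Proof.
move=> u2; apply: eq_summable (sqs_product u2 (sqs_cst l 1)) => x _.
by rewrite mulr1.
Qed.

Lemma sqsD l u v : square_summable l u -> square_summable l v ->
  square_summable l (fun x => u x + v x).
Proof.
move=> u2 v2; split; first exact: measurable_funD u2.1 v2.1.
have uv : summable_on l (fun x => u x ^+ 2 + 2 * (u x * v x) + v x ^+ 2).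
  apply: summableD v2.2; apply: summableD u2.2 _; apply: summableZ.
  exact: sqs_product.
by apply: eq_summable uv => x _; ring.
Qed.

Lemma sqsM_bounded l (M : R) u v : square_summable l u ->
  measurable_fun `]0, l[ v -> (forall x, x \in `]0, l[ -> `|v x| <= M) ->
  square_summable l (fun x => v x * u x).
Proof.
move=> u2 mv vM; split; first exact: measurable_funM mv u2.1.
have := sqs_bounded mv vM => v2.
apply: (@eq_summable _ (fun x => u x ^+ 2 * v x ^+ 2)).
  by move=> x _; rewrite exprMn mulrC.
apply: (@summableM_bounded _ _ (M ^+ 2) _ _ u2.2); first exact: measurable_funX.
move=> x xl; rewrite normrX; apply: lerXn2r; rewrite ?nnegrE ?vM//.
by rewrite (le_trans _ (vM _ xl)).
Qed.

Lemma sqsZ l (c : R) u : square_summable l u -> square_summable l (fun x => c * u x).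
Proof. by move=> u2; apply: (@sqsM_bounded _ `|c|). Qed.

Lemma sqs_eq0 l u : square_summable l u -> antideriv (fun x => u x ^+ 2) l = 0 ->
  aeeq l u (fun=> 0).
Proof.
move=> [mu2 u2] u0.
have : (\int[mu]_(x in `]0%R, l[) `|(u x ^+ 2)%:E| = 0)%E.
  rewrite -[RHS](congr1 EFin u0) /antideriv /Rintegral fineK.
    by apply: eq_integral => x _ /=; rewrite ger0_norm// sqr_ge0.
  exact: integrable_fin_num.
have m2 : measurable_fun `]0, l[ (fun x => (u x ^+ 2)%:E).
  by apply/measurable_EFinP; exact: measurable_funX.
have [+ _] := ae_eq_integral_abs mu (measurable_itv _) m2 => /[apply].
apply: ae_sub => x /[apply] /= -[] /eqP.
by rewrite sqrf_eq0 => /eqP.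
Qed.

Lemma L2P l f : L2 l f <-> square_summable l (fun x => Re (f x)) /\
                           square_summable l (fun x => Im (f x)).
Proof.
split=> [[mr mi fi]|[[mr ri] [mi ii]]].
  have fi' : summable_on l (fun x => Re (f x) ^+ 2 + Im (f x) ^+ 2).
    apply/integrableP; split.
      apply/measurable_EFinP; apply: measurable_funD; exact: measurable_funX.
    under eq_integral => x _ do
      rewrite /= ger0_norm ?addr_ge0 ?sqr_ge0//.
    exact: fi.
  split; split=> //; apply: (@summable_le _ _ _ _ _ fi'); try exact: measurable_funX.
    by move=> x _; rewrite ger0_norm ?sqr_ge0// lerDl sqr_ge0.
  by move=> x _; rewrite ger0_norm ?sqr_ge0// lerDr sqr_ge0.
split=> //.
have /integrableP[_] := summableD ri ii.
under eq_integral => x _ do rewrite /= ger0_norm ?addr_ge0 ?sqr_ge0//.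
by [].
Qed.

End ComplexInterval.

(** * Integrals of complex-valued functions *)

Section ComplexIntegral.
Context {R : realType}.
Notation Re := complex.Re.
Notation Im := complex.Im.
Implicit Types (l : R) (u v : R -> R) (f g h F G : R -> R[i]).

Lemma eq_sqs l u v : (forall x, x \in `]0, l[ -> u x = v x) ->
  square_summable l u -> square_summable l v.
Proof.
move=> uv [mu_ ui]; split; first exact: eq_measurable_oo uv _.
by apply: eq_summable ui => x xl; rewrite uv.
Qed.

Lemma L2D l f g : L2 l f -> L2 l g -> L2 l (fun x => f x + g x).
Proof.
move=> /L2P[fr fi] /L2P[gr gi]; apply/L2P; split.
  by apply: eq_sqs (sqsD fr gr) => x _; rewrite ReD.
by apply: eq_sqs (sqsD fi gi) => x _; rewrite ImD.
Qed.

Lemma L2Z l (c : R[i]) f : L2 l f -> L2 l (fun x => c * f x).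
Proof.
move=> /L2P[fr fi]; apply/L2P; split.
  apply: eq_sqs (sqsD (sqsZ (Re c) fr) (sqsZ (- Im c) fi)) => x _.
  by rewrite ReM mulNr.
apply: eq_sqs (sqsD (sqsZ (Re c) fi) (sqsZ (Im c) fr)) => x _.
by rewrite ImM.
Qed.

Lemma eq_L2 l f g : (forall x, x \in `]0, l[ -> f x = g x) -> L2 l f -> L2 l g.
Proof.
by move=> fg /L2P[fr fi]; apply/L2P; split;
  [apply: eq_sqs fr|apply: eq_sqs fi] => x xl; rewrite fg.
Qed.

Lemma L2N l f : L2 l f -> L2 l (fun x => - f x).
Proof. by move=> /(L2Z (-1)); apply: eq_L2 => x _; rewrite mulN1r. Qed.

Lemma L2B l f g : L2 l f -> L2 l g -> L2 l (fun x => f x - g x).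
Proof. by move=> f2 /L2N; exact: L2D. Qed.

Lemma L2J l f : L2 l f -> L2 l (fun x => (f x)^*).
Proof.
move=> /L2P[fr fi]; apply/L2P; split.
  by apply: eq_sqs fr => x _; rewrite ReJ.
by apply: eq_sqs (sqsZ (-1) fi) => x _; rewrite ImJ mulN1r.
Qed.

Lemma L2_cst l (c : R[i]) : L2 l (fun=> c).
Proof. by apply/L2P; split; exact: sqs_cst. Qed.

Lemma L2_real l u : square_summable l u -> L2 l (fun x => (u x)%:C).
Proof. by move=> u2; apply/L2P; split => //; exact: sqs_cst. Qed.

Lemma L2M_bounded l (M : R) u f : L2 l f -> measurable_fun `]0, l[ u ->
  (forall x, x \in `]0, l[ -> `|u x| <= M) -> L2 l (fun x => (u x)%:C * f x).
Proof.
move=> /L2P[fr fi] mv uM; apply/L2P; split.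
  by apply: eq_sqs (sqsM_bounded fr mv uM) => x _; rewrite ReM ImC mul0r subr0.
by apply: eq_sqs (sqsM_bounded fi mv uM) => x _; rewrite ImM ImC mul0r addr0.
Qed.

Definition csummable l f : Prop :=
  summable_on l (fun x => Re (f x)) /\ summable_on l (fun x => Im (f x)).

Lemma L2_csummable l f : L2 l f -> csummable l f.
Proof. by move=> /L2P[fr fi]; split; exact: sqs_summable. Qed.

Lemma csummable_product l f g : L2 l f -> L2 l g -> csummable l (fun x => f x * g x).
Proof.
move=> /L2P[fr fi] /L2P[gr gi]; split.
  apply: eq_summable (summableB (sqs_product fr gr) (sqs_product fi gi)) => x _.
  by rewrite ReM.
apply: eq_summable (summableD (sqs_product fr gi) (sqs_product fi gr)) => x _.
by rewrite ImM.
Qed.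

Lemma csummableS l x f : x <= l -> csummable l f -> csummable x f.
Proof. by move=> xl [fr fi]; split; exact: summableS xl _. Qed.

Lemma eq_csummable l f g : (forall x, x \in `]0, l[ -> f x = g x) ->
  csummable l f -> csummable l g.
Proof.
by move=> fg [fr fi]; split; [apply: eq_summable fr|apply: eq_summable fi]
  => x xl; rewrite fg.
Qed.

Lemma csummableD l f g : csummable l f -> csummable l g ->
  csummable l (fun x => f x + g x).
Proof.
move=> [fr fi] [gr gi]; split.
  by apply: eq_summable (summableD fr gr) => x _; rewrite ReD.
by apply: eq_summable (summableD fi gi) => x _; rewrite ImD.
Qed.

Lemma csummableZ l (c : R[i]) f : csummable l f -> csummable l (fun x => c * f x).
Proof.
move=> [fr fi]; split.
  apply: eq_summable (summableB (summableZ (Re c) fr) (summableZ (Im c) fi)) => x _.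
  by rewrite ReM.
apply: eq_summable (summableD (summableZ (Re c) fi) (summableZ (Im c) fr)) => x _.
by rewrite ImM.
Qed.

Lemma csummableN l f : csummable l f -> csummable l (fun x => - f x).
Proof. by move=> /(csummableZ (-1)); apply: eq_csummable => x _; rewrite mulN1r. Qed.

Lemma Re_cintegral l f : Re (cintegral l f) = antideriv (fun x => Re (f x)) l.
Proof. by []. Qed.

Lemma Im_cintegral l f : Im (cintegral l f) = antideriv (fun x => Im (f x)) l.
Proof. by []. Qed.

Lemma eq_cintegral l f g : (forall x, x \in `]0, l[ -> f x = g x) ->
  cintegral l f = cintegral l g.
Proof.
by move=> fg; apply: complexP; apply: eq_antideriv => x xl; rewrite fg.
Qed.

Lemma cintegral_aeeq l f g : csummable l f -> csummable l g -> aeeq l f g ->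
  cintegral l f = cintegral l g.
Proof.
move=> [fr fi] [gr gi] fg; apply: complexP; apply: antideriv_aeeq;
  try exact: summable_on_measurable.
- by apply: ae_sub fg => x + xl => ->.
- by apply: ae_sub fg => x + xl => ->.
Qed.

Lemma cintegral_le0 l f : l <= 0 -> cintegral l f = 0.
Proof. by move=> l0; apply: complexP; exact: antideriv_le0. Qed.

Lemma cintegral_at0 f : cintegral 0 f = 0.
Proof. exact: cintegral_le0. Qed.

Lemma cintegralD l f g : csummable l f -> csummable l g ->
  cintegral l (fun x => f x + g x) = cintegral l f + cintegral l g.
Proof.
move=> [fr fi] [gr gi]; apply: complexP; rewrite ?ReD ?ImD ?Re_cintegral ?Im_cintegral.
  by under eq_antideriv do rewrite ReD; rewrite antiderivD.
by under eq_antideriv do rewrite ImD; rewrite antiderivD.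
Qed.

Lemma cintegralZ l (c : R[i]) f : csummable l f ->
  cintegral l (fun x => c * f x) = c * cintegral l f.
Proof.
move=> [fr fi]; apply: complexP; rewrite ?ReM ?ImM ?Re_cintegral ?Im_cintegral.
  under eq_antideriv do rewrite ReM.
  by rewrite antiderivB ?antiderivZ//; exact: summableZ.
under eq_antideriv do rewrite ImM.
by rewrite antiderivD ?antiderivZ//; exact: summableZ.
Qed.

Lemma cintegralN l f : csummable l f ->
  cintegral l (fun x => - f x) = - cintegral l f.
Proof.
by move=> fs; under eq_cintegral do rewrite -mulN1r; rewrite cintegralZ// mulN1r.
Qed.

Lemma cintegralB l f g : csummable l f -> csummable l g ->
  cintegral l (fun x => f x - g x) = cintegral l f - cintegral l g.
Proof. by move=> fs gs; rewrite cintegralD ?cintegralN//; exact: csummableN. Qed.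

Lemma cintegralJ l f : csummable l f ->
  cintegral l (fun x => (f x)^*) = (cintegral l f)^*.
Proof.
move=> [fr fi]; apply: complexP; rewrite ?ReJ ?ImJ ?Re_cintegral ?Im_cintegral.
  by apply: eq_antideriv => x _; rewrite ReJ.
by under eq_antideriv do rewrite ImJ; rewrite antiderivN.
Qed.

Lemma cintegral0 l : cintegral l (fun=> 0 : R[i]) = 0.
Proof.
have e := cintegralZ 0 (L2_csummable (L2_cst l 1)).
rewrite [RHS]mul0r in e; rewrite -[RHS]e.
by apply: eq_cintegral => x _; rewrite mul0r.
Qed.

Lemma cintegral_cst l (c : R[i]) : 0 <= l -> cintegral l (fun=> c) = c * l%:C.
Proof.
by move=> l0; apply: complexP; rewrite ?ReM ?ImM ?ReC ?ImC ?mulr0 ?subr0 ?add0r;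
  exact: antideriv_cst.
Qed.


(** The integrand is the square of the modulus of [f], in the form in which it
    comes out of integrations by parts. *)
Lemma L2_eq0 l f : L2 l f -> Re (cintegral l (fun x => f x * (f x)^*)) = 0 ->
  aeeq l f (fun=> 0).
Proof.
move=> /L2P[fr fi]; rewrite Re_cintegral.
under eq_antideriv do rewrite !ReE ImJ mulrN opprK -!expr2.
rewrite antiderivD; [|exact: fr.2|exact: fi.2] => f0.
have r0 : 0 <= antideriv (fun x => Re (f x) ^+ 2) l.
  by apply: antideriv_ge0 => x _; exact: sqr_ge0.
have i0 : 0 <= antideriv (fun x => Im (f x) ^+ 2) l.
  by apply: antideriv_ge0 => x _; exact: sqr_ge0.
have := sqs_eq0 fr; have := sqs_eq0 fi.
move/eqP: f0; rewrite paddr_eq0// => /andP[/eqP -> /eqP ->].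
move=> /(_ erefl) im0 /(_ erefl) re0.
by apply: ae_sub (ae_and re0 im0) => x [rx ix] xl; apply: complexP;
  rewrite ?rx ?ix.
Qed.

Lemma cintegral_by_parts0 l f g : csummable l f -> csummable l g ->
  cintegral l (fun x => f x * cintegral x g + cintegral x f * g x) =
  cintegral l f * cintegral l g.
Proof.
move=> [fr fi] [gr gi].
have M u v : summable_on l u -> summable_on l v ->
    summable_on l (fun x => u x * antideriv v x + antideriv u x * v x).
  move=> ui vi; have [Mv vM] := antideriv_bounded vi.
  have [Mu uM] := antideriv_bounded ui.
  apply: summableD.
    apply: (@summableM_bounded _ _ Mv) => //; first exact: antideriv_measurable.
    by move=> x; rewrite in_itv/= => /andP[_ /ltW]; exact: vM.
  apply: (@eq_summable _ _ (fun x => v x * antideriv u x)).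
    by move=> x _; rewrite mulrC.
  apply: (@summableM_bounded _ _ Mu) => //; first exact: antideriv_measurable.
  by move=> x; rewrite in_itv/= => /andP[_ /ltW]; exact: uM.
apply: complexP; rewrite ?ReM ?ImM ?Re_cintegral ?Im_cintegral.
  rewrite -!antideriv_by_parts// -antiderivB; [|exact: M|exact: M].
  by apply: eq_antideriv => x _; rewrite ReD !ReM !Re_cintegral !Im_cintegral; ring.
rewrite -!antideriv_by_parts// -antiderivD; [|exact: M|exact: M].
by apply: eq_antideriv => x _; rewrite ImD !ImM !Re_cintegral !Im_cintegral; ring.
Qed.

End ComplexIntegral.

(** * Weak derivatives and traces *)

Section Primitive.
Context {R : realType}.
Notation mu := (@lebesgue_measure R).
Notation Re := complex.Re.
Notation Im := complex.Im.
Implicit Types (l : R) (u v : R -> R) (f g h F G : R -> R[i]).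

(** Up to equality almost everywhere the functions [F] are the members of
    H^1(0, l) and [g] is the weak derivative. Working with [F], whose values at
    every point of the closed interval are meaningful, reduces traces to the
    values at 0 and [l], and weak derivatives to integrals. *)
Definition primitive l F g : Prop :=
  L2 l g /\ forall x, x \in `[0, l] -> F x = F 0 + cintegral x g.

Lemma itv0l l : 0 < l -> l \in `[0, l].
Proof. by move=> l0; rewrite in_itv/= lexx ltW. Qed.

Lemma itv00 l : 0 < l -> (0 : R) \in `[0, l].
Proof. by move=> l0; rewrite in_itv/= lexx ltW. Qed.

Lemma oo_cc l x : x \in `]0, l[ -> x \in `[0, l].
Proof. by rewrite !in_itv/= => /andP[/ltW -> /ltW ->]. Qed.

Lemma cintegral_primitive l (c : R[i]) g : L2 l g ->
  primitive l (fun x => c + cintegral x g) g.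
Proof. by move=> g2; split=> // x xl; rewrite cintegral_at0 addr0. Qed.

Lemma primitive_continuous l F g : 0 < l -> primitive l F g ->
  {within `[0, l], continuous (fun x => Re (F x))} /\
  {within `[0, l], continuous (fun x => Im (F x))}.
Proof.
move=> l0 [/L2_csummable[gr gi] Fg]; split.
  apply: (@subspace_eq_continuous _ _ _
    (fun x => Re (F 0) + antideriv (fun x => Re (g x)) x)).
    by move=> x; rewrite inE => xl /=; rewrite /from_subspace (Fg x xl) ReD.
  move=> x; apply: cvgD; first exact: cvg_cst.
  exact: (antideriv_continuous (ltW l0) gr).
apply: (@subspace_eq_continuous _ _ _
  (fun x => Im (F 0) + antideriv (fun x => Im (g x)) x)).
  by move=> x; rewrite inE => xl /=; rewrite /from_subspace (Fg x xl) ImD.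
move=> x; apply: cvgD; first exact: cvg_cst.
exact: (antideriv_continuous (ltW l0) gi).
Qed.

Lemma primitive_L2 l F g : 0 < l -> primitive l F g -> L2 l F.
Proof.
move=> l0 /(primitive_continuous l0)[cr ci]; apply/L2P; split.
  have [M FM] := cont_itv_bounded cr.
  apply: (@sqs_bounded _ _ M); first exact: cont_itv_measurable.
  by move=> x /oo_cc; exact: FM.
have [M FM] := cont_itv_bounded ci.
apply: (@sqs_bounded _ _ M); first exact: cont_itv_measurable.
by move=> x /oo_cc; exact: FM.
Qed.

Lemma cc_le l x : x \in `[0, l] -> x <= l.
Proof. by rewrite in_itv/= => /andP[]. Qed.

Lemma primitiveD l F f G g : primitive l F f -> primitive l G g ->
  primitive l (fun x => F x + G x) (fun x => f x + g x).
Proof.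
move=> [f2 Ff] [g2 Gg]; split; first exact: L2D.
move=> x xl; rewrite Ff// Gg// cintegralD; first by rewrite addrACA.
  exact: csummableS (cc_le xl) (L2_csummable f2).
exact: csummableS (cc_le xl) (L2_csummable g2).
Qed.

Lemma primitiveZ l (c : R[i]) F f : primitive l F f ->
  primitive l (fun x => c * F x) (fun x => c * f x).
Proof.
move=> [f2 Ff]; split; first exact: L2Z.
move=> x xl; rewrite Ff// mulrDr cintegralZ//.
exact: csummableS (cc_le xl) (L2_csummable f2).
Qed.

Lemma eq_primitive l F G f g : (forall x, x \in `[0, l] -> F x = G x) ->
  (forall x, x \in `]0, l[ -> f x = g x) -> primitive l F f -> primitive l G g.
Proof.
move=> FG fg [f2 Ff]; split; first exact: eq_L2 fg _.
move=> x xl; rewrite -FG// Ff//.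
have x0 : (0 : R) \in `[0, l].
  by move: xl; rewrite !in_itv/= lexx => /andP[]; exact: le_trans.
rewrite FG//; congr (_ + _); apply: eq_cintegral => y yx; apply: fg.
move: xl yx; rewrite !in_itv/= => /andP[_ xl] /andP[-> yx].
exact: lt_le_trans yx xl.
Qed.

Lemma primitiveN l F f : primitive l F f ->
  primitive l (fun x => - F x) (fun x => - f x).
Proof.
by move=> /(primitiveZ (-1)); apply: eq_primitive => x _; rewrite mulN1r.
Qed.

Lemma primitiveB l F f G g : primitive l F f -> primitive l G g ->
  primitive l (fun x => F x - G x) (fun x => f x - g x).
Proof. by move=> pF /primitiveN; exact: primitiveD. Qed.

Lemma primitiveJ l F f : primitive l F f ->
  primitive l (fun x => (F x)^*) (fun x => (f x)^*).
Proof.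
move=> [f2 Ff]; split; first exact: L2J.
move=> x xl; rewrite Ff// rmorphD cintegralJ//.
exact: csummableS (cc_le xl) (L2_csummable f2).
Qed.

Lemma primitive_cst l (c : R[i]) : primitive l (fun=> c) (fun=> 0).
Proof.
by split=> [|x xl]; [exact: L2_cst|rewrite cintegral0 addr0].
Qed.

Lemma primitive_aeeq l F f g : primitive l F f -> L2 l g -> aeeq l f g ->
  primitive l F g.
Proof.
move=> [f2 Ff] g2 fg; split=> // x xl; rewrite Ff//; congr (_ + _).
apply: cintegral_aeeq.
- exact: csummableS (cc_le xl) (L2_csummable f2).
- exact: csummableS (cc_le xl) (L2_csummable g2).
- apply: ae_sub fg => y fg yx; apply: fg; exact: subset_oo0 (cc_le xl) _ yx.
Qed.

Lemma primitive_by_parts l F f G g : 0 < l -> primitive l F f ->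
  primitive l G g ->
  cintegral l (fun x => f x * G x + F x * g x) = F l * G l - F 0 * G 0.
Proof.
move=> l0 pF pG; have F2 := primitive_L2 l0 pF; have G2 := primitive_L2 l0 pG.
have [f2 Ff] := pF; have [g2 Gg] := pG.
have If2 : L2 l (fun x => cintegral x f).
  have := L2B F2 (L2_cst l (F 0)); apply: eq_L2 => x /oo_cc xl.
  by rewrite Ff// addrC addKr.
have Ig2 : L2 l (fun x => cintegral x g).
  have := L2B G2 (L2_cst l (G 0)); apply: eq_L2 => x /oo_cc xl.
  by rewrite Gg// addrC addKr.
have fs := L2_csummable f2; have gs := L2_csummable g2.
transitivity (cintegral l (fun x => (f x * cintegral x g + cintegral x f * g x) +
    (G 0 * f x + F 0 * g x))).
  by apply: eq_cintegral => x /oo_cc xl; rewrite Ff// Gg//; ring.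
rewrite cintegralD; last 2 first.
- by apply: csummableD; exact: csummable_product.
- by apply: csummableD; exact: csummableZ.
rewrite cintegral_by_parts0// cintegralD ?cintegralZ//; try exact: csummableZ.
by rewrite (Ff l) ?(Gg l) ?itv0l//; ring.
Qed.

(** Weak derivatives are unique: see [antideriv_eq0_ae]. *)
Lemma primitive_inj l F f g : primitive l F f -> primitive l F g -> aeeq l f g.
Proof.
move=> [f2 Ff] [g2 Fg].
have [fgr fgi] := L2_csummable (L2B f2 g2).
have fg0 x : x \in `[0, l] -> cintegral x (fun x => f x - g x) = 0.
  move=> xl; rewrite cintegralB.
  - by apply/eqP; rewrite subr_eq0 -(inj_eq (addrI (F 0))) -Ff// -Fg.
  - exact: csummableS (cc_le xl) (L2_csummable f2).
  - exact: csummableS (cc_le xl) (L2_csummable g2).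
have r0 := antideriv_eq0_ae fgr (fun x xl => congr1 (@Re R) (fg0 x xl)).
have i0 := antideriv_eq0_ae fgi (fun x xl => congr1 (@Im R) (fg0 x xl)).
apply: ae_sub (ae_and r0 i0) => x [rx ix] xl; apply/eqP; rewrite -subr_eq0.
by apply/eqP/complexP; rewrite ?rx ?ix.
Qed.

(** If the two functions differ at a point, they differ on an interval of positive
    length. *)
Lemma continuous_aeeq l u v : 0 < l -> {within `[0, l], continuous u} ->
  {within `[0, l], continuous v} -> aeeq l u v ->
  forall x, x \in `[0, l] -> u x = v x.
Proof.
move=> l0 /subspace_continuousP cu /subspace_continuousP cv [N [mN N0 uvN]] x xl.
apply: contrapT => /eqP; rewrite -subr_eq0 -normr_gt0 => uvx.
have cd : u y - v y @[y --> within `[0, l] (nbhs x)] --> u x - v x.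
  by apply: cvgB; [exact: cu|exact: cv].
have /= := (@cvgrPdist_lt _ _ _ _ _ _ _).1 cd _ uvx.
rewrite near_withinE => -[d /= d0 dx].
pose a := Num.max 0 (x - d); pose b := Num.min l (x + d).
have ab : a < b.
  move: xl; rewrite in_itv/= => /andP[x0 xl].
  by rewrite /a /b gt_max !lt_min l0 /=; do ?[apply/andP; split]; lra.
have abN : `]a, b[%classic `<=` N.
  move=> y /=; rewrite in_itv/= /a /b gt_max lt_min => /andP[/andP[y0 xy] /andP[yl yx]].
  apply: uvN => /=; rewrite in_itv/= y0 yl => /(_ isT) uvy.
  have bxy : `|x - y| < d by rewrite ltr_distl; apply/andP; split; lra.
  have ycc : y \in `[0, l] by rewrite in_itv/= !ltW.
  by have := dx y bxy ycc; rewrite uvy subrr subr0 ltxx.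
have : (mu `]a, b[ <= 0)%E by rewrite -N0; apply: le_measure => //; rewrite inE.
by rewrite lebesgue_measure_itv/= lte_fin ab -EFinD lee_fin leNgt subr_gt0 ab.
Qed.

Lemma continuous_rep_inj l f F G : 0 < l -> is_continuous_rep l f F ->
  is_continuous_rep l f G -> forall x, x \in `[0, l] -> F x = G x.
Proof.
move=> l0 [Fr Fi Ff] [Gr Gi Gf] x xl.
apply: complexP.
  apply: (@continuous_aeeq l (fun x => Re (F x)) (fun x => Re (G x))) => //.
  by apply: ae_sub (ae_and Ff Gf) => y [+ +] yl => -> // ->.
apply: (@continuous_aeeq l (fun x => Im (F x)) (fun x => Im (G x))) => //.
by apply: ae_sub (ae_and Ff Gf) => y [+ +] yl => -> // ->.
Qed.

Lemma primitive_continuous_rep l F f g : 0 < l -> primitive l F g ->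
  aeeq l F f -> is_continuous_rep l f F.
Proof. by move=> l0 /(primitive_continuous l0)[Fr Fi] Ff; split. Qed.

Lemma trace_primitive l F f g b : 0 < l -> primitive l F g -> aeeq l F f ->
  trace l f b = F (if b then l else 0).
Proof.
move=> l0 pF Ff; have FR := primitive_continuous_rep l0 pF Ff.
rewrite /trace; case: xgetP => [c -> [G GR <-]|/(_ (F (if b then l else 0)))].
  by apply: (continuous_rep_inj l0 GR FR); case: b; rewrite ?itv0l ?itv00.
by case; exists F.
Qed.

Lemma primitive_C1 l u : 0 < l -> (forall x, derivable u x 1) ->
  continuous (derive1 u) ->
  primitive l (fun x => (u x)%:C) (fun x => (derive1 u x)%:C).
Proof.
move=> l0 du cu'; split.
  have [|M uM] := @cont_itv_bounded _ l (derive1 u).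
    exact: continuous_subspaceT.
  apply: L2_real; apply: (@sqs_bounded _ _ M) => [|x /oo_cc]; last exact: uM.
  by apply: measurable_funS (continuous_measurable_fun cu').
have cu : continuous u.
  by move=> x; apply: differentiable_continuous; apply/derivable1_diffP.
move=> x; rewrite in_itv/= le_eqVlt => /andP[/predU1P[<-|x0] xl].
  by rewrite cintegral_at0 addr0.
have ui : mu.-integrable `[0, x] (EFin \o derive1 u).
  apply: continuous_compact_integrable; first exact: segment_compact.
  exact: continuous_subspaceT.
have : (\int[mu]_(y in `[0%R, x]) (derive1 u y)%:E = (u x)%:E - (u 0)%:E)%E.
  apply: continuous_FTC2 => //; first exact: continuous_subspaceT.
  split=> //; first by apply: cvg_at_right_filter; exact: cu.
  by apply: cvg_at_left_filter; exact: cu.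
move=> /(congr1 fine) /= FTC; apply: complexP; rewrite ?ReD ?ImD /=.
  rewrite /Rintegral; apply/eqP; rewrite addrC -subr_eq -FTC; apply/eqP.
  rewrite -[LHS]/(Rintegral mu _ (derive1 u)) -[RHS]/(Rintegral mu _ (derive1 u)).
  rewrite -Rintegral_itv_obnd_cbnd.
    rewrite -Rintegral_itv_bndo_bndc//.
    apply: integrableS ui => //; apply: subset_itvScc; rewrite bnd_simp//.
  by apply: integrableS ui => //; apply: subset_itvScc; rewrite bnd_simp.
by rewrite /Rintegral integral0 addr0.
Qed.

Lemma test_fun_primitive l phi : 0 < l -> test_fun l phi ->
  [/\ primitive l (fun x => (phi x)%:C) (fun x => (derive1 phi x)%:C),
      phi 0 = 0 & phi l = 0].
Proof.
move=> l0 [dphi cphi [a [b [a0 bl phi0]]]]; split; first exact: primitive_C1.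
  by apply: phi0; rewrite in_itv/= leNgt a0.
by apply: phi0; rewrite in_itv/= (leNgt l) bl andbF.
Qed.

(** A test function is itself a primitive vanishing at both ends, hence this is
    an integration by parts. *)
Lemma primitive_weak_derivative l F f g : 0 < l -> primitive l F g ->
  L2 l f -> aeeq l F f -> is_weak_derivative l f g.
Proof.
move=> l0 pF f2 Ff phi /(test_fun_primitive l0)[pphi phi0 phil].
have := primitive_by_parts l0 pF pphi; rewrite phi0 phil !mulr0 subrr.
have F2 := primitive_L2 l0 pF; have phi2 := primitive_L2 l0 pphi.
rewrite cintegralD; last 2 first.
- exact: csummable_product pF.1 phi2.
- exact: csummable_product F2 pphi.1.
move/eqP; rewrite addrC addr_eq0 => /eqP <-.
apply: cintegral_aeeq; [exact: csummable_product f2 pphi.1|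
  exact: csummable_product F2 pphi.1|].
by apply: ae_sub Ff => x + xl => ->.
Qed.

(** The difference between [f] and a primitive of its weak derivative is
    orthogonal to all derivatives of test functions, hence constant. *)
Lemma weak_derivative_primitive l f g : 0 < l -> L2 l f -> L2 l g ->
  is_weak_derivative l f g -> exists2 F, primitive l F g & aeeq l F f.
Proof.
move=> l0 f2 g2 fg; have pG := cintegral_primitive 0 g2.
set G := (fun x => _) in pG; have G2 := primitive_L2 l0 pG.
have Gg := primitive_weak_derivative l0 pG G2 (aeW _ (fun _ _ => erefl)).
have [ur ui] := L2_csummable (L2B f2 G2).
have u0 phi : test_fun l phi ->
    cintegral l (fun x => (f x - G x) * (derive1 phi x)%:C) = 0.
  move=> tphi; have [[phi2 _] _ _] := test_fun_primitive l0 tphi.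
  under eq_cintegral do rewrite mulrBl.
  rewrite cintegralB; try exact: csummable_product.
  by rewrite fg// Gg// subrr.
have [|kr krP] := du_bois_reymond l0 ur.
  move=> phi /u0/(congr1 (@Re R)) uphi; rewrite -[RHS]uphi Re_cintegral.
  by apply: eq_antideriv => x _; rewrite ReM ImC mulr0 subr0.
have [|ki kiP] := du_bois_reymond l0 ui.
  move=> phi /u0/(congr1 (@Im R)) uphi; rewrite -[RHS]uphi Im_cintegral.
  by apply: eq_antideriv => x _; rewrite ImM ImC mulr0 add0r.
exists (fun x => kr +i* ki + cintegral x g); first exact: cintegral_primitive.
apply: ae_sub (ae_and krP kiP) => x [rx ix] xl.
have : f x - G x = kr +i* ki by apply: complexP; rewrite ?rx ?ix.
by rewrite /G add0r => <-; rewrite subrK.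
Qed.

Lemma weak_derivativeP l F f g : 0 < l -> primitive l F g -> L2 l f ->
  aeeq l F f -> L2 l (weak_derivative l f) /\ aeeq l (weak_derivative l f) g.
Proof.
move=> l0 pF f2 Ff; have fg := primitive_weak_derivative l0 pF f2 Ff.
rewrite /weak_derivative; case: xgetP => [h -> [h2 fh]|/(_ g)]; last first.
  by case; split=> //; exact: pF.1.
split=> //; have [H pH Hf] := weak_derivative_primitive l0 f2 h2 fh.
apply: (primitive_inj pH); apply: (eq_primitive _ _ pF) => // x xl.
apply: (@continuous_rep_inj l f) xl => //.
  exact: primitive_continuous_rep pF Ff.
exact: primitive_continuous_rep pH Hf.
Qed.

End Primitive.

(** * Second-order theory on an interval *)

Section SecondOrder.
Context {R : realType}.
Implicit Types (l : R) (f g h u p F G : R -> R[i]).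

Definition primitive2 l F F1 F2 : Prop := primitive l F F1 /\ primitive l F1 F2.

Lemma primitive2D l F F1 F2 G G1 G2 : primitive2 l F F1 F2 ->
  primitive2 l G G1 G2 ->
  primitive2 l (fun x => F x + G x) (fun x => F1 x + G1 x) (fun x => F2 x + G2 x).
Proof. by move=> [pF pF1] [pG pG1]; split; exact: primitiveD. Qed.

Lemma primitive2B l F F1 F2 G G1 G2 : primitive2 l F F1 F2 ->
  primitive2 l G G1 G2 ->
  primitive2 l (fun x => F x - G x) (fun x => F1 x - G1 x) (fun x => F2 x - G2 x).
Proof. by move=> [pF pF1] [pG pG1]; split; exact: primitiveB. Qed.

Lemma primitive2Z l (c : R[i]) F F1 F2 : primitive2 l F F1 F2 ->
  primitive2 l (fun x => c * F x) (fun x => c * F1 x) (fun x => c * F2 x).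
Proof. by move=> [pF pF1]; split; exact: primitiveZ. Qed.

Lemma primitive2J l F F1 F2 : primitive2 l F F1 F2 ->
  primitive2 l (fun x => (F x)^*) (fun x => (F1 x)^*) (fun x => (F2 x)^*).
Proof. by move=> [pF pF1]; split; exact: primitiveJ. Qed.

Lemma primitive2_exists l g : 0 < l -> L2 l g -> exists G G1, primitive2 l G G1 g.
Proof.
move=> l0 g2; have pG1 := cintegral_primitive 0 g2.
by do 2 eexists; split; [exact: (cintegral_primitive 0 (primitive_L2 l0 pG1))|].
Qed.

Lemma aeeq_refl l f : aeeq l f f.
Proof. exact: aeW. Qed.

Lemma aeeq_sym l f g : aeeq l f g -> aeeq l g f.
Proof. by apply: ae_sub => x + xl => ->. Qed.

Lemma aeeq_trans l f g h : aeeq l f g -> aeeq l g h -> aeeq l f h.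
Proof.
move=> fg gh; apply: ae_sub (ae_and fg gh) => x [+ +] xl.
by move=> /(_ xl) -> /(_ xl).
Qed.

Lemma sobolev2P l f : 0 < l ->
  sobolev 2 l f <->
  L2 l f /\ exists F F1 F2, primitive2 l F F1 F2 /\ aeeq l F f.
Proof.
move=> l0; split=> [[f2 [g fg [g2 [h gh [h2 _]]]]]|[f2 [F [F1 [F2 [[pF pF1] Ff]]]]]].
  have [F pF Ff] := weak_derivative_primitive l0 f2 g2 fg.
  have [G pG Gg] := weak_derivative_primitive l0 g2 h2 gh.
  split=> //; exists F, G, h; split=> //; split=> //.
  by apply: primitive_aeeq pF (primitive_L2 l0 pG) _; exact: aeeq_sym.
split=> //; exists F1; first exact: primitive_weak_derivative pF f2 Ff.
split; first exact: pF.1.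
exists F2; last by split=> //; exact: pF1.1.
by apply: primitive_weak_derivative pF1 pF.1 _ => //; exact: aeeq_refl.
Qed.

Lemma sobolev21 l f : sobolev 2 l f -> sobolev 1 l f.
Proof. by move=> [f2 [g fg [g2 _]]]; split=> //; exists g. Qed.

Section Representative.
Variables (l : R) (f F F1 F2 : R -> R[i]).
Hypotheses (l0 : 0 < l) (pF : primitive2 l F F1 F2) (f2 : L2 l f).
Hypothesis Ff : aeeq l F f.

Lemma trace_rep b : trace l f b = F (if b then l else 0).
Proof. exact: trace_primitive l0 pF.1 Ff. Qed.

Lemma weak_derivative_rep : aeeq l F1 (weak_derivative l f).
Proof. by apply: aeeq_sym; exact: (weak_derivativeP l0 pF.1 f2 Ff).2. Qed.

Let weak_derivative_L2 : L2 l (weak_derivative l f).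
Proof. exact: (weak_derivativeP l0 pF.1 f2 Ff).1. Qed.

Lemma trace_derivative_rep b :
  trace l (weak_derivative l f) b = F1 (if b then l else 0).
Proof. exact: trace_primitive l0 pF.2 weak_derivative_rep. Qed.

Lemma weak_derivative2_rep :
  aeeq l F2 (weak_derivative l (weak_derivative l f)).
Proof.
apply: aeeq_sym.
exact: (weak_derivativeP l0 pF.2 weak_derivative_L2 weak_derivative_rep).2.
Qed.

End Representative.

Lemma green l F F1 F2 G G1 G2 : 0 < l -> primitive2 l F F1 F2 ->
  primitive2 l G G1 G2 ->
  cintegral l (fun x => F2 x * G x) - cintegral l (fun x => F x * G2 x) =
  (F1 l * G l - F l * G1 l) - (F1 0 * G 0 - F 0 * G1 0).
Proof.
move=> l0 [pF pF1] [pG pG1].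
have F_2 := primitive_L2 l0 pF; have G_2 := primitive_L2 l0 pG.
have e1 := primitive_by_parts l0 pF1 pG.
have e2 := primitive_by_parts l0 pF pG1.
rewrite cintegralD in e1; last 2 first.
- exact: csummable_product pF1.1 G_2.
- exact: csummable_product pF.1 pG.1.
rewrite cintegralD in e2; last 2 first.
- exact: csummable_product pF.1 pG.1.
- exact: csummable_product F_2 pG1.1.
transitivity ((F1 l * G l - F1 0 * G 0) - (F l * G1 l - F 0 * G1 0)); last by ring.
by rewrite -e1 -e2; ring.
Qed.

Definition cubic (a b c d : R[i]) (x : R) : R[i] :=
  a + b * x%:C + c * (x ^+ 2)%:C + d * (x ^+ 3)%:C.

Lemma primitive_monomial l n : 0 < l ->
  primitive l (fun x => (x ^+ n.+1)%:C) (fun x => n.+1%:R * (x ^+ n)%:C).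
Proof.
move=> l0; have d1X : derive1 (fun y : R => y ^+ n.+1) = (fun x => n.+1%:R * x ^+ n).
  by apply/funext => x; rewrite exp_derive1.
have [||p2 pE] := @primitive_C1 _ l (fun x => x ^+ n.+1) l0.
- by move=> x; exact: exprn_derivable.
- rewrite d1X => x; apply: cvgM; first exact: cvg_cst.
  exact: exprn_continuous.
apply: eq_primitive (conj p2 pE) => // x _.
by rewrite d1X rmorphM rmorph_nat.
Qed.

Lemma primitive_cubic l a b c d : 0 < l ->
  primitive l (cubic a b c d) (cubic b (2 * c) (3 * d) 0).
Proof.
move=> l0.
have p1 := primitiveZ b (primitive_monomial 0 l0).
have p2 := primitiveZ c (primitive_monomial 1 l0).
have p3 := primitiveZ d (primitive_monomial 2 l0).
have := primitiveD (primitiveD (primitiveD (primitive_cst l a) p1) p2) p3.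
by apply: eq_primitive => x _; rewrite /cubic ?expr1 ?expr0 ?rmorph1; ring.
Qed.

(** Hermite interpolation by cubics. That the second derivative has second
    derivative zero makes it orthogonal to [F''] for all [F] in H^2_0. *)
Lemma hermite l (a0 a1 b0 b1 : R[i]) : 0 < l -> exists F F1 F2 F3,
  [/\ primitive2 l F F1 F2, primitive2 l F2 F3 (fun=> 0),
      F 0 = a0 /\ F1 0 = a1 & F l = b0 /\ F1 l = b1].
Proof.
move=> l0; have lN0 : l%:C != 0 by apply/eqP => -[/eqP]; rewrite gt_eqF.
pose c := (3 * (b0 - a0) - l%:C * (2 * a1 + b1)) / l%:C ^+ 2.
pose d := (2 * (a0 - b0) + l%:C * (a1 + b1)) / l%:C ^+ 3.
exists (cubic a0 a1 c d), (cubic a1 (2 * c) (3 * d) 0).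
exists (cubic (2 * c) (2 * (3 * d)) (3 * 0) 0).
exists (cubic (2 * (3 * d)) (2 * (3 * 0)) (3 * 0) 0).
split.
- by split; exact: primitive_cubic.
- split; first exact: primitive_cubic.
  apply: (eq_primitive _ _ (primitive_cubic _ _ _ _ l0)) => // x _.
  by rewrite /cubic; ring.
- by split; rewrite /cubic !expr0n /= rmorph0 !mulr0 !addr0.
- by split; rewrite /cubic !rmorphXn /c /d; field.
Qed.

(** Let [P] be a second primitive of [p]. By Green's identity [v := u - P] is
    orthogonal to [F''] for all [F] in H^2_0. Subtracting from a second primitive
    [W] of [v] the Hermite cubic [C] with the same boundary data gives such an
    [F], with [F'' = v - C'']; as [C''] is also orthogonal to [F''], the function
    [v - C''] is orthogonal to itself, and [u = P + C''] is in H^2. *)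
Lemma weak_second_derivative l u p : 0 < l -> L2 l u -> L2 l p ->
  (forall F F1 F2, primitive2 l F F1 F2 ->
     F 0 = 0 -> F1 0 = 0 -> F l = 0 -> F1 l = 0 ->
     cintegral l (fun x => F2 x * (u x)^*) = cintegral l (fun x => F x * (p x)^*)) ->
  exists U U1, primitive2 l U U1 p /\ aeeq l U u.
Proof.
move=> l0 u2 p2 up; have [P [P1 pP]] := primitive2_exists l0 p2.
have P_2 := primitive_L2 l0 pP.1.
pose v x := u x - P x; have v2 : L2 l v by exact: L2B.
have v0 F F1 F2 : primitive2 l F F1 F2 ->
    F 0 = 0 -> F1 0 = 0 -> F l = 0 -> F1 l = 0 ->
    cintegral l (fun x => F2 x * (v x)^*) = 0.
  move=> pF F00 F10 Fl0 F1l0.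
  under eq_cintegral do rewrite /v rmorphB mulrBr.
  rewrite cintegralB; last 2 first.
  - exact: csummable_product pF.2.1 (L2J u2).
  - exact: csummable_product pF.2.1 (L2J P_2).
  rewrite (up _ _ _ pF)//.
  have := green l0 pF (primitive2J pP).
  rewrite F00 F10 Fl0 F1l0 !mul0r !subrr => /eqP; rewrite subr_eq0 => /eqP ->.
  by rewrite subrr.
have [W [W1 pW]] := primitive2_exists l0 v2.
have [C [C1 [C2 [C3 [pC pC2 [C00 C10] [Cl0 C1l0]]]]]] :=
  hermite (W 0) (W1 0) (W l) (W1 l) l0.
have pF := primitive2B pW pC.
have C2_2 := primitive_L2 l0 pC2.1.
have vC : aeeq l (fun x => v x - C2 x) (fun=> 0).
  apply: L2_eq0; first exact: L2B.
  under eq_cintegral do rewrite rmorphB mulrBr.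
  rewrite cintegralB; last 2 first.
  - by apply: csummable_product; [exact: L2B|exact: L2J].
  - by apply: csummable_product; [exact: L2B|exact: L2J].
  rewrite (v0 _ _ _ pF) ?C00 ?C10 ?Cl0 ?C1l0 ?subrr//.
  have := green l0 pF (primitive2J pC2).
  rewrite C00 C10 Cl0 C1l0 !subrr !mul0r !subrr rmorph0.
  under [X in _ - X]eq_cintegral do rewrite mulr0.
  by rewrite cintegral0 subr0 sub0r => ->; rewrite oppr0.
have pU := primitive2D pP pC2.
exists (fun x => P x + C2 x), (fun x => P1 x + C3 x); split.
  by split; [exact: pU.1|apply: (eq_primitive _ _ pU.2) => // x _; rewrite addr0].
apply: ae_sub vC => x + xl => /(_ xl) /eqP; rewrite subr_eq0 => /eqP <-.
by rewrite /v addrC subrK.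
Qed.

End SecondOrder.

(** * The Dirichlet problem on an edge *)

Section DirichletProblem.
Context {R : realType}.
Notation Re := complex.Re.
Variables (l M : R) (q : R -> R).
Hypotheses (l0 : 0 < l) (q_measurable : measurable_fun `]0, l[ q).
Hypothesis q_bounds : forall x, x \in `]0, l[ -> 0 <= q x <= M.
Implicit Types F : R -> R[i].

Let M0 : 0 <= M.
Proof.
have l2 : l / 2 \in `]0, l[ by rewrite in_itv/= divr_gt0//= ltr_pdivrMr// ltr_pMr// ltr1n.
by have /andP[q0 qM] := q_bounds l2; exact: le_trans qM.
Qed.

Let q_norm x : x \in `]0, l[ -> `|q x| <= M.
Proof. by move=> /q_bounds/andP[q0 qM]; rewrite ger0_norm. Qed.

Section InitialValueProblem.
Variables (a b : R).
Hypotheses (a0 : 0 <= a) (b0 : 0 <= b).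

Let k := M + 1.
Let K := a + b * l.

(** Picard iteration for [y'' = q y], [y 0 = a], [y' 0 = b], started at 0. As
    [q >= 0], the iterates are nondecreasing, and they stay below the
    supersolution [K * expR (k * x)], since [M <= k ^+ 2]. Their limit is a
    solution by dominated convergence. *)
Let picard (y : R -> R) x : R :=
  a + b * x + antideriv (antideriv (fun t => q t * y t)) x.

Let y_ n : R -> R := iter n picard (fun=> 0).

Let k1 : 1 <= k. Proof. by rewrite /k lerDr. Qed.

Let K0 : 0 <= K. Proof. by rewrite addr_ge0// mulr_ge0// ltW. Qed.

Let k_gt0 : 0 < k. Proof. exact: lt_le_trans k1. Qed.

Let bnd x : R := K * expR (k * x).

Let antideriv_exp x : 0 <= x -> summable_on x (fun t => expR (k * t)) /\
  antideriv (fun t => expR (k * t)) x = (expR (k * x) - 1) / k.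
Proof.
rewrite le_eqVlt => /predU1P[<-|x0].
  rewrite mulr0 expR0 subrr mul0r antideriv0; split=> //.
  by rewrite /summable_on set_itv_ge ?bnd_simp ?ltxx//; exact: integrable_set0.
pose u t := expR (k * t) / k.
have du (t : R) : is_derive t 1 u (expR (k * t)).
  apply: is_derive_eq; rewrite scaler0 add0r /GRing.scale/= mulr1 mulrCA.
  by rewrite mulVf ?gt_eqF// mulr1.
have d1u : derive1 u = (fun t => expR (k * t)).
  by apply/funext => t; rewrite derive1E derive_val.
have [||p2 pE] := @primitive_C1 _ x u x0.
- by move=> t; exact: ex_derive.
- rewrite d1u => t; apply: continuous_comp; last exact: continuous_expR.
  exact: mulrl_continuous.
rewrite d1u in p2 pE; split; first exact: (L2_csummable p2).1.
have := congr1 (@Re R) (pE x (itv0l x0)); rewrite ReD Re_cintegral /= /u.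
by rewrite mulr0 expR0 mulrBl => ->; rewrite addrC addKr.
Qed.

Let bnd_summable x : 0 <= x -> summable_on x bnd.
Proof. by move=> x0; apply: summableZ; exact: (antideriv_exp x0).1. Qed.

Let bndl x : x \in `[0, l] -> bnd x <= bnd l.
Proof.
by rewrite in_itv/= => /andP[_ xl]; rewrite ler_wpM2l// ler_expR ler_pM2l.
Qed.

Let good (y : R -> R) := measurable_fun `]0, l[ y /\
  forall x, x \in `[0, l] -> 0 <= y x <= bnd x.

Let qy_bound y x : good y -> x \in `]0, l[ -> 0 <= q x * y x <= M * bnd x.
Proof.
move=> [_ yb] xl; have /andP[q0 qM] := q_bounds xl.
have /andP[y0 yB] := yb _ (oo_cc xl).
by rewrite mulr_ge0//= ler_pM.
Qed.

Let qy_summable y : good y -> summable_on l (fun t => q t * y t).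
Proof.
move=> gy; apply: (@summable_le _ _ _ (fun x => M * bnd x)).
- by apply: measurable_funM => //; exact: gy.1.
- by apply: summableZ; apply: bnd_summable; exact: ltW.
- move=> x xl; have /andP[h0 h1] := qy_bound gy xl.
  by rewrite ger0_norm.
Qed.

Let iqy_summable y : good y -> summable_on l (antideriv (fun t => q t * y t)).
Proof.
move=> gy; have gs := qy_summable gy; have [B yB] := antideriv_bounded gs.
apply: (@summable_bounded _ _ B); first exact: antideriv_measurable.
by move=> x /oo_cc/cc_le; exact: yB.
Qed.

Let iqy_bound y x : good y -> x \in `[0, l] ->
  0 <= antideriv (fun t => q t * y t) x <= M * K / k * expR (k * x).
Proof.
move=> gy xl; have /andP[x0 xl'] : 0 <= x <= l by move: xl; rewrite in_itv.
have sub t : t \in `]0, x[ -> t \in `]0, l[ by exact: subset_oo0.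
apply/andP; split.
  by apply: antideriv_ge0 => t /sub/(qy_bound gy)/andP[].
apply: (@le_trans _ _ (antideriv (fun t => M * bnd t) x)).
  apply: le_antideriv.
  - exact: summableS xl' (qy_summable gy).
  - by apply: summableZ; exact: bnd_summable.
  - by move=> t /sub/(qy_bound gy)/andP[].
rewrite antiderivZ ?antiderivZ//; [|exact: (antideriv_exp x0).1|exact: bnd_summable].
rewrite (antideriv_exp x0).2 -!mulrA ler_wpM2l// ler_wpM2l// mulrC ler_wpM2l//.
  by rewrite invr_ge0 ltW.
by rewrite gerBl.
Qed.

Let picard_good y : good y -> good (picard y).
Proof.
move=> gy; split.
  apply: measurable_funD; last exact: antideriv_measurable (iqy_summable gy).
  by apply: measurable_funD => //; exact: measurable_funM.
move=> x xl; have /andP[x0 xl'] : 0 <= x <= l by move: xl; rewrite in_itv.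
have sub t : t \in `]0, x[ -> t \in `[0, l].
  by move=> tx; apply: oo_cc; exact: subset_oo0 tx.
apply/andP; split.
  rewrite /picard addr_ge0 ?addr_ge0 ?mulr_ge0//.
  by apply: antideriv_ge0 => t /sub/(iqy_bound gy)/andP[].
have : antideriv (antideriv (fun t => q t * y t)) x <=
       antideriv (fun t => M * K / k * expR (k * t)) x.
  apply: le_antideriv.
  - exact: summableS xl' (iqy_summable gy).
  - by apply: summableZ; exact: (antideriv_exp x0).1.
  - by move=> t /sub/(iqy_bound gy)/andP[].
rewrite antiderivZ; last exact: (antideriv_exp x0).1.
rewrite (antideriv_exp x0).2 => h; rewrite /picard /bnd.
have e1 : 1 <= expR (k * x) by rewrite -expR0 ler_expR mulr_ge0// ltW.
have abx : a + b * x <= K by rewrite lerD2l ler_wpM2l.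
apply: (le_trans (lerD abx h)).
suff : M * K / k * ((expR (k * x) - 1) / k) <= K * (expR (k * x) - 1) by lra.
rewrite (_ : _ / k * _ = (M / k / k) * (K * (expR (k * x) - 1))); last by ring.
rewrite ler_piMl ?mulr_ge0 ?subr_ge0// ler_pdivrMr// ler_pdivrMr// mul1r.
by rewrite /k; have := M0; nra.
Qed.

Let y_good n : good (y_ n).
Proof.
elim: n => [|n IHn]; last exact: picard_good.
by split=> [|x xl]; [exact: measurable_cst|rewrite /y_ /= lexx /= mulr_ge0// expR_ge0].
Qed.

Let picard_mono y z : good y -> good z ->
  (forall x, x \in `[0, l] -> y x <= z x) ->
  forall x, x \in `[0, l] -> picard y x <= picard z x.
Proof.
move=> gy gz yz x xl; rewrite lerD2l.
have sub t s : t \in `[0, l] -> s \in `]0, t[ -> s \in `]0, l[.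
  by move=> tl; exact: subset_oo0 (cc_le tl) _.
apply: le_antideriv.
- exact: summableS (cc_le xl) (iqy_summable gy).
- exact: summableS (cc_le xl) (iqy_summable gz).
move=> t /(sub _ _ xl)/oo_cc tl; apply: le_antideriv.
- exact: summableS (cc_le tl) (qy_summable gy).
- exact: summableS (cc_le tl) (qy_summable gz).
move=> s /(sub _ _ tl) sl; rewrite ler_wpM2l//; last exact/yz/oo_cc.
by have /andP[] := q_bounds sl.
Qed.

Let y_incr x : x \in `[0, l] -> nondecreasing_seq (fun n => y_ n x).
Proof.
move=> xl; apply/nondecreasing_seqP => n; elim: n x xl => [|n IHn] x xl.
  by have /andP[] := (y_good 1).2 x xl.
exact: (picard_mono (y_good n) (y_good n.+1) IHn).
Qed.

Let y x : R := limn (fun n => y_ n x).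

Let y_cvg x : x \in `[0, l] -> y_ n x @[n --> \oo] --> y x.
Proof.
move=> xl; apply: nondecreasing_is_cvgn; first exact: y_incr.
exists (bnd x) => _ [n _ <-].
by have /andP[] := (y_good n).2 x xl.
Qed.

Let y_bound x : x \in `[0, l] -> 0 <= y x <= bnd l.
Proof.
move=> xl; have cy := cvgP _ (y_cvg xl); apply/andP; split.
  by apply: limr_ge => //; apply: nearW => n; have /andP[] := (y_good n).2 x xl.
apply: limr_le => //; apply: nearW => n.
have /andP[_ h] := (y_good n).2 x xl; exact: le_trans h (bndl xl).
Qed.

Let qy_dct x : x \in `[0, l] -> summable_on x (fun t => q t * y t) /\
  antideriv (fun t => q t * y_ n t) x @[n --> \oo] -->
  antideriv (fun t => q t * y t) x.
Proof.
move=> xl; apply: (@antideriv_dct _ _ _ _ (fun t => M * bnd t)).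
- move=> n; apply: summable_on_measurable.
  exact: summableS (cc_le xl) (qy_summable (y_good n)).
- apply: summableZ; apply: bnd_summable.
  by move: xl; rewrite in_itv/= => /andP[].
- move=> n t tx; have tl := subset_oo0 (cc_le xl) tx.
  by have /andP[h0 h1] := qy_bound (y_good n) tl; rewrite ger0_norm.
- move=> t tx; have tl : t \in `]0, l[ := subset_oo0 (cc_le xl) tx.
  by apply: cvgM; [exact: cvg_cst|exact/y_cvg/oo_cc].
Qed.

Let y_eq x : x \in `[0, l] -> y x = picard y x.
Proof.
move=> xl; have sub t : t \in `]0, x[ -> t \in `[0, l].
  by move=> tx; apply: oo_cc; exact: subset_oo0 (cc_le xl) _ tx.
have x0 : 0 <= x by move: xl; rewrite in_itv/= => /andP[].
have [||||_ cI] := @antideriv_dct _ x (fun n => antideriv (fun t => q t * y_ n t))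
  (antideriv (fun t => q t * y t)) (fun t => M * K / k * expR (k * t)).
- move=> n; apply: summable_on_measurable.
  exact: summableS (cc_le xl) (iqy_summable (y_good n)).
- by apply: summableZ; exact: (antideriv_exp x0).1.
- move=> n t /sub tl; have /andP[h0 h1] := iqy_bound (y_good n) tl.
  by rewrite ger0_norm.
- by move=> t /sub tl; exact: (qy_dct tl).2.
have cP : y_ n.+1 x @[n --> \oo] --> picard y x.
  by rewrite /y_ /=; apply: cvgD => //; exact: cvg_cst.
apply: (cvg_unique _ _ cP) => //=.
by have := y_cvg xl; rewrite -(cvg_shiftS (fun n => y_ n x)).
Qed.

Lemma initial_value_problem : exists y y1 : R -> R,
  [/\ primitive2 l (fun x => (y x)%:C) (fun x => (y1 x)%:C)
                   (fun x => (q x)%:C * (y x)%:C),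
      y 0 = a & a + b * l <= y l].
Proof.
exists y, (fun x => b + antideriv (fun t => q t * y t) x).
have qys := (qy_dct (itv0l l0)).1.
have qy2 : L2 l (fun x => (q x)%:C * (y x)%:C).
  apply: eq_L2 (L2_real (_ : square_summable l (fun t => q t * y t))).
    by move=> x _; rewrite rmorphM.
  apply: (@sqs_bounded _ _ (M * bnd l)); first exact: summable_on_measurable.
  move=> x xl; have /andP[y0 yB] := y_bound (oo_cc xl).
  by rewrite normrM (ger0_norm y0) ler_pM// q_norm.
have p1 : primitive l (fun x => (b + antideriv (fun t => q t * y t) x)%:C)
    (fun x => (q x)%:C * (y x)%:C).
  split=> // x xl; rewrite antideriv0 addr0; apply: complexP;
    rewrite ?ReD ?ImD /=.
    rewrite -[Rintegral _ _ _]/(antideriv _ x); congr (_ + _).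
    by apply: eq_antideriv => t _; rewrite mulr0 subr0.
  rewrite add0r -[Rintegral _ _ _]/(antideriv _ x).
  rewrite (@eq_antideriv _ _ _ (fun=> 0)) ?antideriv_cst ?mul0r//.
    by move: xl; rewrite in_itv/= => /andP[].
  by move=> t _; rewrite mulr0 mul0r addr0.
split.
- split=> //; split; first exact: primitive_L2 p1.
  move=> x xl; rewrite y_eq// (y_eq (itv00 l0)) /picard mulr0 antideriv0 !addr0.
  have x0 : 0 <= x by move: xl; rewrite in_itv/= => /andP[].
  have [ps _] := L2_csummable (primitive_L2 l0 p1).
  have Is := summableB ps (summable_cst l b).
  apply: complexP; rewrite ?ReD ?ImD /=.
    rewrite -[Rintegral _ _ _]/(antideriv _ x) -addrA; congr (_ + _).
    rewrite antiderivD ?antideriv_cst//; first exact: summable_cst.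
    apply: summableS (cc_le xl) _; apply: eq_summable Is => t _ /=.
    by rewrite addrC addKr.
  by rewrite add0r -[Rintegral _ _ _]/(antideriv _ x) antideriv_cst// mul0r.
- by rewrite (y_eq (itv00 l0)) /picard mulr0 antideriv0 !addr0.
rewrite (y_eq (itv0l l0)) /picard lerDl; apply: antideriv_ge0 => t tl.
apply: antideriv_ge0 => s st.
have sl : s \in `]0, l[ by exact: subset_oo0 (cc_le (oo_cc tl)) _ st.
have /andP[q0 _] := q_bounds sl.
by have /andP[y0 _] := y_bound (oo_cc sl); exact: mulr_ge0.
Qed.

End InitialValueProblem.

(** The solution with data [y 0 = 0], [y' 0 = 1] is positive at [l] because
    [q >= 0], so it corrects the value at [l]. *)
Lemma dirichlet_exists (c d : R[i]) : exists F F1,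
  [/\ primitive2 l F F1 (fun x => (q x)%:C * F x), F 0 = c & F l = d].
Proof.
have [u [u1 [pu u0 _]]] := initial_value_problem ler01 (lexx 0).
have [v [v1 [pv v0 vl]]] := initial_value_problem (lexx 0) ler01.
have vl0 : (v l)%:C != 0.
  apply/eqP => -[/eqP]; rewrite gt_eqF//; apply: lt_le_trans vl.
  by rewrite add0r mul1r.
pose e := (d - c * (u l)%:C) / (v l)%:C.
have [pF pF1] := primitive2D (primitive2Z c pu) (primitive2Z e pv).
exists (fun x => c * (u x)%:C + e * (v x)%:C).
exists (fun x => c * (u1 x)%:C + e * (v1 x)%:C); split.
- by split=> //; apply: eq_primitive pF1 => // x _; ring.
- by rewrite u0 v0 mulr1 mulr0 addr0.
- by rewrite /e divfK// addrC subrK.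
Qed.

(** Energy: the integral of [q |F|^2 + |F'|^2] vanishes, and [q >= 0]. *)
Lemma dirichlet_unique F (F1 : R -> R[i]) : primitive2 l F F1 (fun x => (q x)%:C * F x) ->
  F 0 = 0 -> F l = 0 -> forall x, x \in `[0, l] -> F x = 0.
Proof.
move=> [pF pF1] F0 Fl; have F2 := primitive_L2 l0 pF.
have := primitive_by_parts l0 pF1 (primitiveJ pF).
rewrite F0 Fl !rmorph0 !mulr0 subrr cintegralD; last 2 first.
- exact: csummable_product pF1.1 (L2J F2).
- exact: csummable_product pF.1 (L2J pF.1).
move=> /(congr1 (@Re R)); rewrite ReD => energy.
have qF : 0 <= Re (cintegral l (fun x => (q x)%:C * F x * (F x)^*)).
  rewrite Re_cintegral; apply: antideriv_ge0 => x xl.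
  rewrite -mulrA ReM ImC mul0r subr0 ReC mulr_ge0//.
    by have /andP[] := q_bounds xl.
  by rewrite ReM ReJ ImJ mulrN opprK -!expr2 addr_ge0// sqr_ge0.
have F1F1 : 0 <= Re (cintegral l (fun x => F1 x * (F1 x)^*)).
  rewrite Re_cintegral; apply: antideriv_ge0 => x xl.
  by rewrite ReM ReJ ImJ mulrN opprK -!expr2 addr_ge0// sqr_ge0.
have F10 : aeeq l F1 (fun=> 0).
  apply: (L2_eq0 pF.1); move/eqP: energy; rewrite paddr_eq0//.
  by move=> /andP[_ /eqP].
move=> x xl; have [_ ->//] := primitive_aeeq pF (L2_cst l 0) F10.
by rewrite F0 cintegral0 addr0.
Qed.

End DirichletProblem.

(** * Functions on the graph *)

Section GraphFunctions.
Context {R : realType} (G : metric_graph R).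
Implicit Types (e : edge G) (v i j : 'I_(nvert G)) (p : edge G * bool).
Implicit Types (f g h F : graph_fun G).

Definition endpoint p : R := if p.2 then len p.1 else 0.

(** The sign for which [outward p * F' (endpoint p)] is the derivative of [F]
    towards the vertex at which [p] is located. *)
Definition outward p : R[i] := if p.2 then 1 else -1.

(** [F], with classical derivative [F1] and almost everywhere second derivative
    [F2], is the regular member of the class of [f]. *)
Definition represents (F F1 F2 f : graph_fun G) : Prop := forall e,
  [/\ primitive2 (len e) (F e) (F1 e) (F2 e), aeeq (len e) (F e) (f e) &
      L2 (len e) (f e)].

Definition continuous_H2 f : Prop := tildeH 2 f /\ gH1 f.

Lemma tildeH2P f : tildeH 2 f <-> exists F F1 F2, represents F F1 F2 f.
Proof.
split=> [f2|[F [F1 [F2 rf]]] e]; last first.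
  have [pF Ff f2] := rf e; apply/sobolev2P; first exact: len_gt0.
  by split=> //; exists (F e), (F1 e), (F2 e).
have /choice[F FP] e : exists F : R -> R[i], exists F1 F2 : R -> R[i],
    [/\ primitive2 (len e) F F1 F2, aeeq (len e) F (f e) & L2 (len e) (f e)].
  by have /(sobolev2P _ (len_gt0 e))[fe2 [F [F1 [F2 []]]]] := f2 e; exists F, F1, F2.
have [F1 F1P] := choice FP; have [F2 F2P] := choice F1P.
by exists F, F1, F2.
Qed.

Lemma represents_self F F1 F2 :
  (forall e, primitive2 (len e) (F e) (F1 e) (F2 e)) -> represents F F1 F2 F.
Proof.
move=> pF e; split; [exact: pF|exact: aeeq_refl|].
exact: primitive_L2 (len_gt0 e) (pF e).1.
Qed.

Lemma represents_aeeq F F1 F2 f g : represents F F1 F2 f -> gaeeq f g -> gL2 g ->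
  represents F F1 F2 g.
Proof.
move=> rf fg g2 e; have [pF Ff _] := rf e; split=> //.
exact: aeeq_trans Ff (fg e).
Qed.

Lemma represents_lin F F1 F2 f H H1 H2 h (c : R[i]) : represents F F1 F2 f ->
  represents H H1 H2 h ->
  represents (fun e x => F e x + c * H e x) (fun e x => F1 e x + c * H1 e x)
    (fun e x => F2 e x + c * H2 e x) (fun e x => f e x + c * h e x).
Proof.
move=> rf rh e; have [pF Ff f2] := rf e; have [pH Hh h2] := rh e; split.
- exact: primitive2D pF (primitive2Z c pH).
- by apply: ae_sub (ae_and Ff Hh) => x [+ +] xl => -> // ->.
- exact: L2D f2 (L2Z c h2).
Qed.

Section Representative.
Variables (F F1 F2 f : graph_fun G).
Hypothesis rf : represents F F1 F2 f.

Lemma represents_gL2 : gL2 f. Proof. by move=> e; have [] := rf e. Qed.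

Lemma represents_tildeH2 : tildeH 2 f.
Proof. by apply/tildeH2P; exists F, F1, F2. Qed.

Lemma represents_L2 e : L2 (len e) (F e).
Proof. by have [[pF _] _ _] := rf e; exact: primitive_L2 (len_gt0 e) pF. Qed.

Lemma represents_L2_2 e : L2 (len e) (F2 e).
Proof. by have [[_ pF1] _ _] := rf e; exact: pF1.1. Qed.

Lemma gtrace_represents p : gtrace f p = F p.1 (endpoint p).
Proof.
by have [pF Ff f2] := rf p.1; exact: (trace_rep (len_gt0 _) pF Ff).
Qed.

Lemma gtrace_gderiv_represents p : gtrace (gderiv f) p = F1 p.1 (endpoint p).
Proof.
by have [pF Ff f2] := rf p.1; exact: (trace_derivative_rep (len_gt0 _) pF f2 Ff).
Qed.

Lemma gderiv2_represents : gaeeq (gderiv (gderiv f)) F2.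
Proof.
move=> e; have [pF Ff f2] := rf e; apply: aeeq_sym.
exact: (weak_derivative2_rep (len_gt0 _) pF f2 Ff).
Qed.

Lemma normal_derivative_represents v :
  normal_derivative f v =
  \sum_(p | loc p == v) outward p * F1 p.1 (endpoint p).
Proof.
apply: eq_bigr => p _; rewrite gtrace_gderiv_represents /outward.
by case: p.2; rewrite ?mul1r ?mulN1r.
Qed.

Lemma gH1_represents :
  gH1 f <-> forall p p', loc p = loc p' -> F p.1 (endpoint p) = F p'.1 (endpoint p').
Proof.
split=> [[_ cf] p p' /cf|cF]; first by rewrite !gtrace_represents.
split=> [e|p p' pp']; last by rewrite !gtrace_represents; exact: cF.
by apply: sobolev21; exact: represents_tildeH2.
Qed.

Lemma vertex_value_represents p : gH1 f ->
  vertex_value f (loc p) = F p.1 (endpoint p).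
Proof.
move=> [_ cf]; rewrite -gtrace_represents /vertex_value.
case: pickP => [p' /eqP p'p|/(_ p)]; first exact: cf.
by rewrite eqxx.
Qed.

End Representative.

Lemma loc_surjective : connected_graph G -> forall v, exists p, loc p = v.
Proof.
move=> Gc v; have /card_gt0P[e0 _] := edge_nonempty G.
have [->|v0] := eqVneq v (src e0); first by exists (e0, false).
have /connectP[[|w s] /=] := Gc v (src e0).
  by move=> _ /esym/eqP; rewrite (negPf v0).
move=> /andP[/existsP[e /orP[/andP[/eqP ev _]|/andP[_ /eqP ev]]] _] _.
  by exists (e, false).
by exists (e, true).
Qed.

(** Green's identity on all the edges, the boundary terms being indexed by the
    endpoints so that they can be regrouped by vertices. *)
Lemma graph_green F F1 F2 H H1 H2 :
  (forall e, primitive2 (len e) (F e) (F1 e) (F2 e)) ->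
  (forall e, primitive2 (len e) (H e) (H1 e) (H2 e)) ->
  inner F2 H - inner F H2 =
  \sum_p outward p * (F1 p.1 (endpoint p) * (H p.1 (endpoint p))^*
                      - F p.1 (endpoint p) * (H1 p.1 (endpoint p))^*).
Proof.
move=> pF pH; rewrite /inner -sumrB.
rewrite -(pair_bigA _ (fun e b => outward (e, b) *
  (F1 e (endpoint (e, b)) * (H e (endpoint (e, b)))^*
   - F e (endpoint (e, b)) * (H1 e (endpoint (e, b)))^*))) /=.
apply: eq_bigr => e _; rewrite big_bool /outward /endpoint /= mul1r mulN1r.
exact: (green (len_gt0 e) (pF e) (primitive2J (pH e))).
Qed.

Lemma inner_aeeq f g f' g' : gL2 f -> gL2 g -> gL2 f' -> gL2 g' ->
  gaeeq f f' -> gaeeq g g' -> inner f g = inner f' g'.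
Proof.
move=> f2 g2 f'2 g'2 ff' gg'; apply: eq_bigr => e _; apply: cintegral_aeeq.
- exact: csummable_product (f2 e) (L2J (g2 e)).
- exact: csummable_product (f'2 e) (L2J (g'2 e)).
by apply: ae_sub (ae_and (ff' e) (gg' e)) => x [+ +] xl => -> // ->.
Qed.

End GraphFunctions.

(** * The adjoint of the minimal operator *)

Section Operator.
Context {R : realType} (G : metric_graph R) (q : potential G).
(* a Borel representative of [q], nonnegative and bounded everywhere *)
Variables (q0 : potential G) (M : R).
Hypotheses (q0_measurable : forall e, measurable_fun `]0, len e[ (q0 e))
  (q0_bounds : forall e x, x \in `]0, len e[ -> 0 <= q0 e x <= M)
  (q_q0 : forall e, aeeq (len e) (q e) (q0 e)).
Implicit Types (e : edge G) (v i j : 'I_(nvert G)) (p : edge G * bool).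
Implicit Types (f g h F : graph_fun G).

Definition potential_mul f : graph_fun G := fun e x => (q0 e x)%:C * f e x.

Let q0_norm e x : x \in `]0, len e[ -> `|q0 e x| <= M.
Proof. by move=> /q0_bounds/andP[q00 q0M]; rewrite ger0_norm. Qed.

Lemma potential_mul_L2 e f : L2 (len e) (f e) -> L2 (len e) (potential_mul f e).
Proof.
move=> f2; rewrite /potential_mul.
exact: (L2M_bounded f2 (@q0_measurable e) (@q0_norm e)).
Qed.

Lemma schroedinger_represents F F1 F2 f : represents F F1 F2 f ->
  gaeeq (schroedinger q f) (fun e x => - F2 e x + potential_mul F e x).
Proof.
move=> rf e; have [_ Ff _] := rf e; have F2f := gderiv2_represents rf e.
rewrite /schroedinger /potential_mul.
apply: ae_sub (ae_and (q_q0 e) (ae_and Ff F2f)) => x [+ [+ +]] xl.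
by move=> /(_ xl) -> /(_ xl) -> /(_ xl) ->.
Qed.

Lemma schroedinger_represents_L2 F F1 F2 f : represents F F1 F2 f ->
  gL2 (fun e x => - F2 e x + potential_mul F e x).
Proof.
move=> rf e; apply: L2D; first by apply: L2N; exact: represents_L2_2 rf e.
by apply: potential_mul_L2; exact: represents_L2 rf e.
Qed.

Lemma inner_potential f g :
  inner (potential_mul f) g = inner f (potential_mul g).
Proof.
apply: eq_bigr => e _; apply: eq_cintegral => x _.
by rewrite /potential_mul conjM conj_real; ring.
Qed.

Lemma innerBl f f' g : gL2 f -> gL2 f' -> gL2 g ->
  inner (fun e x => - f e x + f' e x) g = - inner f g + inner f' g.
Proof.
move=> f2 f'2 g2; rewrite /inner -sumrN -big_split; apply: eq_bigr => e _ /=.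
have fg := csummable_product (f2 e) (L2J (g2 e)).
have f'g := csummable_product (f'2 e) (L2J (g2 e)).
rewrite -cintegralN// -cintegralD//; last exact: csummableN.
by apply: eq_cintegral => x _; rewrite mulrDl mulNr.
Qed.

Lemma innerBr f g g' : gL2 f -> gL2 g -> gL2 g' ->
  inner f (fun e x => - g e x + g' e x) = - inner f g + inner f g'.
Proof.
move=> f2 g2 g'2; rewrite /inner -sumrN -big_split; apply: eq_bigr => e _ /=.
have fg := csummable_product (f2 e) (L2J (g2 e)).
have fg' := csummable_product (f2 e) (L2J (g'2 e)).
rewrite -cintegralN// -cintegralD//; last exact: csummableN.
by apply: eq_cintegral => x _; rewrite conjD conjN mulrDr mulrN.
Qed.

Lemma S_op_intro F F1 F2 : connected_graph G ->
  (forall e, primitive2 (len e) (F e) (F1 e) (F2 e)) ->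
  (forall p, F p.1 (endpoint p) = 0) ->
  (forall v, \sum_(p | loc p == v) outward p * F1 p.1 (endpoint p) = 0) ->
  S_op q F (fun e x => - F2 e x + potential_mul F e x).
Proof.
move=> Gc pF F0 F10; have rF := represents_self pF.
have cF : gH1 F by apply/(gH1_represents rF) => p p'; rewrite !F0.
split=> //.
- exact: represents_tildeH2 rF.
- move=> v; rewrite (normal_derivative_represents rF) F10; split=> //.
  by have [p <-] := loc_surjective Gc v; rewrite (vertex_value_represents rF).
- exact: schroedinger_represents_L2 rF.
- by move=> e; apply: aeeq_sym; exact: schroedinger_represents rF e.
Qed.

Lemma S_op_elim f Tf : S_op q f Tf -> exists F F1 F2,
  [/\ represents F F1 F2 f, forall p, F p.1 (endpoint p) = 0,
      forall v, \sum_(p | loc p == v) outward p * F1 p.1 (endpoint p) = 0,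
      gL2 Tf & gaeeq Tf (fun e x => - F2 e x + potential_mul F e x)].
Proof.
move=> [/tildeH2P[F [F1 [F2 rf]]] cf f0 Tf2 Tff].
exists F, F1, F2; split=> //.
- by move=> p; rewrite -(vertex_value_represents rf)//; exact: (f0 _).1.
- by move=> v; rewrite -(normal_derivative_represents rf); exact: (f0 v).2.
- by move=> e; exact: aeeq_trans (Tff e) (schroedinger_represents rf e).
Qed.

Lemma sum_by_vertex (A : edge G * bool -> R[i]) (c : 'I_(nvert G) -> R[i]) :
  (forall v, \sum_(p | loc p == v) A p = 0) -> \sum_p A p * c (loc p) = 0.
Proof.
move=> A0; rewrite (partition_big (@loc _ G) predT)//= big1// => v _.
transitivity ((\sum_(p | loc p == v) A p) * c v); last by rewrite A0 mul0r.
by rewrite mulr_suml; apply: eq_bigr => p /eqP ->.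
Qed.

(** The boundary terms of Green's identity cancel at each vertex: the function in
    the domain of [S] vanishes there, and its derivatives, which sum to zero, are
    multiplied by the common value of [g]. *)
Lemma adjoint_intro g h : connected_graph G -> continuous_H2 g -> gL2 h ->
  gaeeq h (schroedinger q g) -> adjoint (S_op q) g h.
Proof.
move=> Gc [/tildeH2P[H [H1 [H2 rg]]] cg] h2 hg; split=> //.
  exact: represents_gL2 rg.
move=> f Tf /S_op_elim[F [F1 [F2 [rf F0 F10 Tf2 Tff]]]].
have cH := (gH1_represents rg).1 cg.
have hH e : aeeq (len e) (h e) (fun x => - H2 e x + potential_mul H e x).
  exact: aeeq_trans (hg e) (schroedinger_represents rg e).
have Hg : gaeeq g H by move=> e; have [_ /aeeq_sym] := rg e.
have Ff : gaeeq f F by move=> e; have [_ /aeeq_sym] := rf e.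
have F_2 := represents_L2 rf; have H_2 := represents_L2 rg.
have soF := schroedinger_represents_L2 rf.
have soH := schroedinger_represents_L2 rg.
rewrite (inner_aeeq Tf2 (represents_gL2 rg) soF H_2 Tff Hg).
rewrite (inner_aeeq (represents_gL2 rf) h2 F_2 soH Ff hH).
have qF e : L2 (len e) (potential_mul F e) by exact: potential_mul_L2.
have qH e : L2 (len e) (potential_mul H e) by exact: potential_mul_L2.
rewrite innerBl//; last exact: represents_L2_2 rf.
rewrite innerBr//; last exact: represents_L2_2 rg.
rewrite inner_potential; congr (- _ + _); apply/eqP; rewrite -subr_eq0.
rewrite (graph_green (F1 := F1) (H1 := H1)); last 2 first.
- by move=> e; have [] := rf e.
- by move=> e; have [] := rg e.
apply/eqP; rewrite -[RHS](sum_by_vertex (fun v => (vertex_value g v)^*) F10).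
apply: eq_bigr => p _.
by rewrite F0 mul0r subr0 mulrA (vertex_value_represents rg).
Qed.

(** The edges are interpolated independently of each other; see [hermite]. *)
Lemma boundary_data (A : edge G * bool -> R[i]) : exists F F1 F2 : graph_fun G,
  [/\ forall e, primitive2 (len e) (F e) (F1 e) (F2 e),
      forall p, F p.1 (endpoint p) = 0 &
      forall p, outward p * F1 p.1 (endpoint p) = A p].
Proof.
have /choice[F FP] e : exists F : R -> R[i], exists F1 F2 : R -> R[i],
    [/\ primitive2 (len e) F F1 F2, F 0 = 0 /\ F1 0 = - A (e, false) &
        F (len e) = 0 /\ F1 (len e) = A (e, true)].
  have [F [F1 [F2 [F3 [pF _ F0 Fl]]]]] :=
    hermite 0 (- A (e, false)) 0 (A (e, true)) (len_gt0 e).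
  by exists F, F1, F2.
have [F1 F1P] := choice FP; have [F2 F2P] := choice F1P.
exists F, F1, F2; split=> [e|[e b]|[e b]]; have [pF [F0 F10] [Fl F1l]] := F2P e.
- exact: pF.
- by case: b.
by case: b; rewrite /outward /endpoint /= ?F10 ?F1l ?mul1r// mulN1r opprK.
Qed.

(** Testing with functions supported in one edge gives [g'' = q g - h]; testing
    with functions vanishing at the vertices and with derivatives [1] and [-1]
    at two endpoints located at the same vertex gives the continuity of [g]. *)
Lemma adjoint_elim g h : connected_graph G -> adjoint (S_op q) g h ->
  [/\ continuous_H2 g, gL2 h & gaeeq h (schroedinger q g)].
Proof.
move=> Gc [g2 h2 gh].
pose w : graph_fun G := fun e x => potential_mul g e x - h e x.
have w2 e : L2 (len e) (w e) by apply: L2B => //; exact: potential_mul_L2.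
have /choice[H HP] e : exists H : R -> R[i], exists H1 : R -> R[i],
    primitive2 (len e) H H1 (w e) /\ aeeq (len e) H (g e).
  apply: weak_second_derivative => //; first exact: len_gt0.
  move=> F F1 F2 pF F0 F10 Fl F1l.
  (* the test functions are extended by zero to the other edges *)
  pose ext (u : R -> R[i]) : graph_fun G := fun e' => if e' == e then u else fun=> 0.
  have pext e' : primitive2 (len e') (ext F e') (ext F1 e') (ext F2 e').
    rewrite /ext; case: eqP => [->//|_].
    by split; exact: primitive_cst.
  have F_2 := primitive_L2 (len_gt0 e) pF.1.
  have ext0 p : ext F p.1 (endpoint p) = 0.
    rewrite /ext; case: p => e' b /=; case: eqP => // ->.
    by rewrite /endpoint /=; case: b.
  have ext10 p : ext F1 p.1 (endpoint p) = 0.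
    rewrite /ext; case: p => e' b /=; case: eqP => // ->.
    by rewrite /endpoint /=; case: b.
  have Sext : S_op q (ext F) (fun e x => - ext F2 e x + potential_mul (ext F) e x).
    apply: (S_op_intro Gc pext ext0) => v.
    by rewrite big1// => p _; rewrite ext10 mulr0.
  have := gh _ _ Sext.
  rewrite /inner (bigD1 e)//= big1 ?addr0; last first.
    move=> e' /negPf e'e; rewrite /potential_mul /ext e'e -[RHS](cintegral0 (len e')).
    by apply: eq_cintegral => x _; rewrite oppr0 add0r mulr0 mul0r.
  rewrite (bigD1 e)//= big1 ?addr0; last first.
    move=> e' /negPf e'e; rewrite /ext e'e -[RHS](cintegral0 (len e')).
    by apply: eq_cintegral => x _; rewrite mul0r.
  rewrite /ext /potential_mul eqxx => test.
  have cF2g := csummable_product pF.2.1 (L2J (g2 e)).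
  have qF2 := L2M_bounded F_2 (@q0_measurable e) (@q0_norm e).
  have cqFg := csummable_product qF2 (L2J (g2 e)).
  have cFh := csummable_product F_2 (L2J (h2 e)).
  transitivity (cintegral (len e) (fun x => (q0 e x)%:C * F x * (g e x)^*) -
                cintegral (len e) (fun x => F x * (h e x)^*)).
    rewrite -test; transitivity (cintegral (len e) (fun x =>
      (q0 e x)%:C * F x * (g e x)^*) - (- cintegral (len e) (fun x =>
      F2 x * (g e x)^*) + cintegral (len e) (fun x =>
      (q0 e x)%:C * F x * (g e x)^*))); first by ring.
    rewrite -cintegralN// -cintegralD//; last exact: csummableN.
    by congr (_ - _); apply: eq_cintegral => x _; rewrite mulrDl mulNr.
  rewrite -cintegralB//; apply: eq_cintegral => x _.
  by rewrite /w /potential_mul conjD conjN conjM conj_real; ring.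
have [H1 H1P] := choice HP.
have rg : represents H H1 w g by move=> e; have [] := H1P e.
have tg := represents_tildeH2 rg.
have gw : gaeeq h (schroedinger q g).
  move=> e; apply: aeeq_trans (aeeq_sym (schroedinger_represents rg e)).
  have [_ Hg _] := rg e; apply: ae_sub Hg => x + xl => /(_ xl) Hg.
  by rewrite /w /potential_mul Hg opprB -addrA addNr addr0.
split=> //; split=> //; apply/(gH1_represents rg) => p p' pp'.
(* outward derivatives 1 at [p] and -1 at [p'], 0 elsewhere *)
pose A r : R[i] := (r == p)%:R - (r == p')%:R.
have sumA (c : edge G * bool -> R[i]) : \sum_r A r * c r = c p - c p'.
  have one s : \sum_r (r == s)%:R * c r = c s.
    rewrite (bigD1 s)//= eqxx mul1r big1 ?addr0// => r /negPf ->.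
    by rewrite mul0r.
  by rewrite -!one -sumrB; apply: eq_bigr => r _; rewrite -mulrBl.
have A0 v : \sum_(r | loc r == v) A r = 0.
  transitivity (\sum_r A r * (loc r == v)%:R).
    rewrite big_mkcond; apply: eq_bigr => r _.
    by case: eqP; rewrite ?mulr1 ?mulr0.
  by rewrite sumA pp' subrr.
have [F [F1 [F2 [pF F0 F1A]]]] := boundary_data A.
have SF : S_op q F (fun e x => - F2 e x + potential_mul F e x).
  apply: S_op_intro => // v; rewrite -[RHS](A0 v).
  by apply: eq_bigr => r _.
have rF := represents_self pF.
have F_2 := represents_L2 rF; have H_2 := represents_L2 rg.
have soF := schroedinger_represents_L2 rF.
have soH := schroedinger_represents_L2 rg.
have Hg : gaeeq g H by move=> e; have [_ /aeeq_sym] := rg e.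
have hH e : aeeq (len e) (h e) (fun x => - w e x + potential_mul H e x).
  exact: aeeq_trans (gw e) (schroedinger_represents rg e).
have := gh _ _ SF.
rewrite (inner_aeeq soF g2 soF H_2 (fun e => aeeq_refl _ _) Hg).
rewrite (inner_aeeq F_2 h2 F_2 soH (fun e => aeeq_refl _ _) hH).
have qF e : L2 (len e) (potential_mul F e) by exact: potential_mul_L2.
have qH e : L2 (len e) (potential_mul H e) by exact: potential_mul_L2.
rewrite innerBl//; last exact: represents_L2_2 rF.
rewrite innerBr//.
rewrite inner_potential => /addIr/oppr_inj/eqP; rewrite -subr_eq0.
rewrite (graph_green (F1 := F1) (H1 := H1))//; last first.
  by move=> e; have [] := rg e.
under eq_bigr => r _ do rewrite F0 mul0r subr0 mulrA F1A.
rewrite sumA subr_eq0 => /eqP; exact: (can_inj (@conjCK _)).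
Qed.

End Operator.

(** * Vertex values and normal derivatives *)

Section BoundaryValues.
Context {R : realType} (G : metric_graph R).
Implicit Types (e : edge G) (v i j : 'I_(nvert G)) (p : edge G * bool).
Implicit Types (f g h F : graph_fun G).

Lemma represents0 : represents (fun _ _ => 0) (fun _ _ => 0) (fun _ _ => 0)
  ((fun _ _ => 0) : graph_fun G).
Proof. by apply: represents_self => e; split; exact: primitive_cst. Qed.

Lemma vertex_valuesE f v k : vertex_values f v k = vertex_value f v.
Proof. by rewrite /vertex_values mxE. Qed.

Lemma normal_derivativesE f v k : normal_derivatives f v k = normal_derivative f v.
Proof. by rewrite /normal_derivatives mxE. Qed.

Lemma vertex_value0 v : vertex_value ((fun _ _ => 0) : graph_fun G) v = 0.
Proof.
rewrite /vertex_value; case: pickP => // p _.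
by rewrite (gtrace_represents represents0).
Qed.

Lemma normal_derivative0 v : normal_derivative ((fun _ _ => 0) : graph_fun G) v = 0.
Proof.
rewrite (normal_derivative_represents represents0) big1// => p _.
by rewrite mulr0.
Qed.

Lemma vertex_value_aeeq f g v : tildeH 2 f -> gL2 g -> gaeeq f g ->
  vertex_value f v = vertex_value g v.
Proof.
move=> /tildeH2P[F [F1 [F2 rf]]] g2 fg; have rg := represents_aeeq rf fg g2.
rewrite /vertex_value; case: pickP => // p _.
by rewrite (gtrace_represents rf) (gtrace_represents rg).
Qed.

Lemma normal_derivative_aeeq f g v : tildeH 2 f -> gL2 g -> gaeeq f g ->
  normal_derivative f v = normal_derivative g v.
Proof.
move=> /tildeH2P[F [F1 [F2 rf]]] g2 fg; have rg := represents_aeeq rf fg g2.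
by rewrite (normal_derivative_represents rf) (normal_derivative_represents rg).
Qed.

Section LinearCombination.
Variables (f g : graph_fun G) (c : R[i]).
Hypotheses (cf : continuous_H2 f) (cg : continuous_H2 g).
Let s : graph_fun G := fun e x => f e x + c * g e x.

Lemma continuous_H2_lin : continuous_H2 s.
Proof.
have [/tildeH2P[F [F1 [F2 rf]]] kf] := cf.
have [/tildeH2P[H [H1 [H2 rg]]] kg] := cg.
have rs := represents_lin c rf rg; split; first exact: represents_tildeH2 rs.
apply/(gH1_represents rs) => p p' pp'.
by rewrite ((gH1_represents rf).1 kf _ _ pp') ((gH1_represents rg).1 kg _ _ pp').
Qed.

Lemma vertex_value_lin v : vertex_value s v = vertex_value f v + c * vertex_value g v.
Proof.
have [/tildeH2P[F [F1 [F2 rf]]] kf] := cf.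
have [/tildeH2P[H [H1 [H2 rg]]] kg] := cg.
have rs := represents_lin c rf rg.
rewrite /vertex_value; case: pickP => [p _|_]; last by rewrite mulr0 addr0.
by rewrite (gtrace_represents rs) (gtrace_represents rf) (gtrace_represents rg).
Qed.

Lemma normal_derivative_lin v :
  normal_derivative s v = normal_derivative f v + c * normal_derivative g v.
Proof.
have [/tildeH2P[F [F1 [F2 rf]]] kf] := cf.
have [/tildeH2P[H [H1 [H2 rg]]] kg] := cg.
rewrite (normal_derivative_represents (represents_lin c rf rg)).
rewrite (normal_derivative_represents rf) (normal_derivative_represents rg).
rewrite mulr_sumr -big_split; apply: eq_bigr => p _ /=.
by rewrite mulrDr mulrCA.
Qed.

End LinearCombination.

End BoundaryValues.

(** * The kernel, the Dirichlet-to-Neumann matrix and the Krein domain *)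

Section Kernel.
Context {R : realType} (G : metric_graph R) (q : potential G).
Variables (q0 : potential G) (M : R).
Hypotheses (q0_measurable : forall e, measurable_fun `]0, len e[ (q0 e))
  (q0_bounds : forall e x, x \in `]0, len e[ -> 0 <= q0 e x <= M)
  (q_q0 : forall e, aeeq (len e) (q e) (q0 e))
  (G_connected : connected_graph G).
Implicit Types (e : edge G) (v i j : 'I_(nvert G)) (p : edge G * bool).
Implicit Types (f g h F : graph_fun G).

Lemma adjointP g h : adjoint (S_op q) g h <->
  [/\ continuous_H2 g, gL2 h & gaeeq h (schroedinger q g)].
Proof.
split; first exact: (adjoint_elim q0_measurable q0_bounds q_q0 G_connected).
move=> [cg h2 hg].
exact: (adjoint_intro q0_measurable q0_bounds q_q0 G_connected cg h2 hg).
Qed.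

Let kerS f := ker (adjoint (S_op q)) f.

Lemma ker_represents f : kerS f <-> exists F F1,
  represents F F1 (potential_mul q0 F) f /\ gH1 f.
Proof.
split.
  move=> /adjointP[[/tildeH2P[F [F1 [F2 rf]]] cf] _ f0].
  exists F, F1; split=> // e; have [[pF pF1] Ff f2] := rf e; split=> //.
  split=> //; apply: primitive_aeeq pF1 _ _.
    by apply: (potential_mul_L2 q0_measurable q0_bounds); exact: represents_L2 rf e.
  have := aeeq_trans (f0 e) (schroedinger_represents q_q0 rf e).
  apply: ae_sub => x + xl => /(_ xl) /esym/eqP.
  by rewrite addrC subr_eq0 => /eqP ->.
move=> [F [F1 [rf cf]]]; apply/adjointP; split.
- by split=> //; exact: represents_tildeH2 rf.
- exact: represents_gL2 (@represents0 _ G).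
- move=> e; apply: aeeq_sym.
  apply: aeeq_trans (schroedinger_represents q_q0 rf e) _.
  by apply: aeW => x xl; rewrite addNr.
Qed.

Lemma ker_continuous_H2 f : kerS f -> continuous_H2 f.
Proof. by move=> /adjointP[]. Qed.

Lemma ker_lin f g c : kerS f -> kerS g -> kerS (fun e x => f e x + c * g e x).
Proof.
move=> /[dup]/ker_continuous_H2 cf /ker_represents[F [F1 [rf _]]].
move=> /[dup]/ker_continuous_H2 cg /ker_represents[H [H1 [rg _]]].
apply/ker_represents.
exists (fun e x => F e x + c * H e x), (fun e x => F1 e x + c * H1 e x); split.
  rewrite (_ : potential_mul _ _ =
    (fun e x => potential_mul q0 F e x + c * potential_mul q0 H e x)).
    exact: represents_lin.
  by apply/funext => e; apply/funext => x; rewrite /potential_mul; ring.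
exact: (continuous_H2_lin c cf cg).2.
Qed.

Lemma ker0 : kerS (fun _ _ => 0).
Proof.
apply/ker_represents; exists (fun _ _ => 0), (fun _ _ => 0); split.
  rewrite (_ : potential_mul _ _ = fun _ _ => 0); first exact: represents0.
  by apply/funext => e; apply/funext => x; rewrite /potential_mul mulr0.
by apply/(gH1_represents (@represents0 _ G)).
Qed.

Lemma ker_sum (I : Type) (r : seq I) (c : I -> R[i]) (b : I -> graph_fun G) :
  (forall k, kerS (b k)) ->
  [/\ kerS (fun e x => \sum_(k <- r) c k * b k e x),
      forall v, vertex_value (fun e x => \sum_(k <- r) c k * b k e x) v =
                \sum_(k <- r) c k * vertex_value (b k) v &
      forall v, normal_derivative (fun e x => \sum_(k <- r) c k * b k e x) v =
                \sum_(k <- r) c k * normal_derivative (b k) v].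
Proof.
move=> kb; elim: r => [|k r [IHk IHv IHn]].
  rewrite (_ : (fun e x => _) = fun _ _ => 0); last first.
    by apply/funext => e; apply/funext => x; rewrite big_nil.
  split; first exact: ker0.
    by move=> v; rewrite big_nil vertex_value0.
  by move=> v; rewrite big_nil normal_derivative0.
rewrite (_ : (fun e x => _) =
    (fun e x => \sum_(j <- r) c j * b j e x + c k * b k e x)); last first.
  by apply/funext => e; apply/funext => x; rewrite big_cons addrC.
have cs := ker_continuous_H2 IHk; have cb := ker_continuous_H2 (kb k).
split=> [|v|v]; first exact: ker_lin.
  by rewrite vertex_value_lin// IHv big_cons addrC.
by rewrite normal_derivative_lin// IHn big_cons addrC.
Qed.

(** The Dirichlet problems on the edges are independent of each other. *)
Lemma ker_exists (c : 'I_(nvert G) -> R[i]) :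
  exists2 f, kerS f & forall v, vertex_value f v = c v.
Proof.
have /choice[F FP] e : exists F : R -> R[i], exists F1 : R -> R[i],
    [/\ primitive2 (len e) F F1 (fun x => (q0 e x)%:C * F x),
        F 0 = c (src e) & F (len e) = c (tgt e)].
  exact: (dirichlet_exists (len_gt0 e) (@q0_measurable e) (q0_bounds (e := e))).
have [F1 F1P] := choice FP.
have rF : represents F F1 (potential_mul q0 F) F.
  by apply: represents_self => e; have [] := F1P e.
have Fc p : F p.1 (endpoint p) = c (loc p).
  by case: p => e b; have [_ F0 Fl] := F1P e; case: b.
have cF : gH1 F by apply/(gH1_represents rF) => p p' pp'; rewrite !Fc pp'.
exists F; first by apply/ker_represents; exists F, F1.
move=> v; have [p <-] := loc_surjective G_connected v.
by rewrite (vertex_value_represents rF).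
Qed.

(** On each edge the function solves the Dirichlet problem with zero data. *)
Lemma ker_eq0 f : kerS f -> (forall v, vertex_value f v = 0) ->
  gaeeq f (fun _ _ => 0).
Proof.
move=> /ker_represents[F [F1 [rf cf]]] f0 e; have [pF Ff _] := rf e.
have F0 b : F e (endpoint (e, b)) = 0.
  by rewrite -(f0 (loc (e, b))) (vertex_value_represents rf).
have Fe := dirichlet_unique (len_gt0 e) (q0_bounds (e := e)) pF (F0 false) (F0 true).
by apply: ae_sub Ff => x + xl => /(_ xl) <-; rewrite Fe//; exact: oo_cc.
Qed.

Lemma ker_basis_exists : exists b : 'I_(nvert G) -> graph_fun G,
  forall k, kerS (b k) /\ forall v, vertex_value (b k) v = (v == k)%:R.
Proof.
have /choice[b bP] (k : 'I_(nvert G)) : exists f,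
    kerS f /\ forall v, vertex_value f v = (v == k)%:R.
  by have [f kf fv] := ker_exists (fun v => (v == k)%:R); exists f.
by exists b.
Qed.

Lemma sum_delta (c : 'I_(nvert G) -> R[i]) v : \sum_k c k * (v == k)%:R = c v.
Proof.
rewrite (bigD1 v)//= eqxx mulr1 big1 ?addr0// => k /negPf kv.
by rewrite eq_sym kv mulr0.
Qed.

Lemma ker_decompose (b : 'I_(nvert G) -> graph_fun G) f :
  (forall k, kerS (b k) /\ forall v, vertex_value (b k) v = (v == k)%:R) ->
  kerS f -> gaeeq f (fun e x => \sum_k vertex_value f k * b k e x).
Proof.
move=> bP kf; have kb k : kerS (b k) by have [] := bP k.
have [ks sv sn] := ker_sum (index_enum _) (vertex_value f) kb.
set s : graph_fun G := fun e x => _ in ks sv sn *.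
have fs : gaeeq (fun e x => f e x + -1 * s e x) (fun _ _ => 0).
  apply: ker_eq0 => [|v]; first exact: ker_lin.
  rewrite vertex_value_lin; [|exact: ker_continuous_H2..].
  rewrite sv; under eq_bigr do rewrite (bP _).2.
  by rewrite sum_delta mulN1r subrr.
move=> e; apply: ae_sub (fs e) => x + xl.
by move=> /(_ xl)/eqP; rewrite mulN1r subr_eq0 => /eqP.
Qed.

(** The members of the kernel with vertex values 1 at one vertex and 0 at the
    others form a basis. The predicate [W] stands for the kernel of [S^*] and for
    that of the Krein extension. *)
Lemma has_dimension_ker (W : graph_fun G -> Prop) :
  (forall f, W f <-> kerS f) -> has_dimension W (nvert G).
Proof.
move=> WE; have [b bP] := ker_basis_exists.
have kb k : kerS (b k) by have [] := bP k.
exists b; split=> [k|c cb0 k|f /WE kf]; first exact/WE.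
  have [ks sv _] := ker_sum (index_enum _) c kb.
  have := sv k; under eq_bigr do rewrite (bP _).2.
  rewrite sum_delta => <-.
  rewrite (@vertex_value_aeeq _ _ _ (fun _ _ => 0)).
  - exact: vertex_value0.
  - exact: (ker_continuous_H2 ks).1.
  - exact: represents_gL2 (@represents0 _ G).
  - exact: cb0.
by exists (vertex_value f); exact: ker_decompose.
Qed.

Lemma is_dtn_exists : exists A, is_dtn q A.
Proof.
have [b bP] := ker_basis_exists; have kb k : kerS (b k) by have [] := bP k.
exists (\matrix_(i, j) normal_derivative (b j) i) => f kf.
have [ks _ sn] := ker_sum (index_enum _) (vertex_value f) kb.
apply/colP => i; rewrite normal_derivativesE mxE.
rewrite (normal_derivative_aeeq i _ _ (ker_decompose bP kf)).
- by rewrite sn; apply: eq_bigr => j _; rewrite mxE vertex_valuesE mulrC.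
- exact: (ker_continuous_H2 kf).1.
- by have [/tildeH2P[F [F1 [F2 rs]]] _] := ker_continuous_H2 ks;
    exact: represents_gL2 rs.
Qed.

Lemma is_dtn_inj A B : is_dtn q A -> is_dtn q B -> A = B.
Proof.
move=> dA dB; have [b bP] := ker_basis_exists.
apply/matrixP => i j.
have bj : vertex_values (b j) = delta_mx j 0.
  by apply/colP => k; rewrite vertex_valuesE mxE (bP j).2 andbT.
have := dA _ (bP j).1; rewrite (dB _ (bP j).1) bj => /colP/(_ i).
by rewrite -!colE !mxE.
Qed.

Lemma dtn_matrixP : is_dtn q (dtn_matrix q).
Proof. exact: xgetPex is_dtn_exists. Qed.

(** Members of the domain of [S] have no boundary data and members of the kernel
    satisfy the boundary condition by definition of the matrix. Conversely,
    subtract from [f] the member [fs] of the kernel with the same vertex values: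
    the boundary condition says precisely that the normal derivatives of [f] and
    [fs] agree too, so that [f - fs] is in the domain of [S]. *)
Lemma dom_krein f : dom (krein_laplacian q) f <->
  [/\ tildeH 2 f, gH1 f &
      normal_derivatives f = dtn_matrix q *m vertex_values f].
Proof.
split=> [[g [/adjointP[[f2 cf] _ _] [f0 [fs [[g0 Sf0] ks ff0]]]]]|[f2 cf fn]].
  split=> //; have [f02 cf0 f00 _ _] := Sf0.
  have cs := ker_continuous_H2 ks.
  have lin := @continuous_H2_lin _ _ f0 fs 1 (conj f02 cf0) cs.
  have vlin := @vertex_value_lin _ _ f0 fs 1 (conj f02 cf0) cs.
  have nlin := @normal_derivative_lin _ _ f0 fs 1 (conj f02 cf0) cs.
  set s : graph_fun G := fun e x => f0 e x + 1 * fs e x in lin vlin nlin.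
  have fsE : gaeeq f s.
    by move=> e; apply: ae_sub (ff0 e) => x + xl => -> //; rewrite /s mul1r.
  have s2 : gL2 s.
    by have [/tildeH2P[F [F1 [F2 rs]]] _] := lin; exact: represents_gL2 rs.
  have -> : vertex_values f = vertex_values fs.
    apply/colP => v; rewrite !vertex_valuesE (vertex_value_aeeq v f2 s2 fsE) vlin.
    by rewrite (f00 v).1 add0r mul1r.
  rewrite -(dtn_matrixP ks); apply/colP => v.
  apply: etrans (normal_derivativesE f v 0) _.
  apply: etrans (normal_derivative_aeeq v f2 s2 fsE) _.
  apply: etrans (nlin v) (etrans _ (esym (normal_derivativesE fs v 0))).
  apply: etrans (congr1 (fun z => z + _) (f00 v).2) _.
  by rewrite mul1r add0r.
have /tildeH2P[F [F1 [F2 rf]]] := f2.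
have [fs ks fsv] := ker_exists (vertex_value f).
have cs := ker_continuous_H2 ks.
have lin := @continuous_H2_lin _ _ f fs (-1) (conj f2 cf) cs.
have vlin := @vertex_value_lin _ _ f fs (-1) (conj f2 cf) cs.
have nlin := @normal_derivative_lin _ _ f fs (-1) (conj f2 cf) cs.
set f0 : graph_fun G := fun e x => f e x + -1 * fs e x in lin vlin nlin.
have so2 F' F1' F2' f' : represents F' F1' F2' f' ->
    gL2 (fun e x => - F2' e x + potential_mul q0 F' e x).
  exact: (schroedinger_represents_L2 q0_measurable q0_bounds).
exists (fun e x => - F2 e x + potential_mul q0 F e x); split.
  apply/adjointP; split=> //; first exact: so2 rf.
  by move=> e; apply: aeeq_sym; exact: (schroedinger_represents q_q0 rf e).
exists f0, fs; split=> //; last first.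
  by move=> e; apply: aeW => x xl; rewrite /f0 mulN1r subrK.
have [/tildeH2P[H [H1 [H2 r0]]] c0] := lin.
exists (fun e x => - H2 e x + potential_mul q0 H e x); split=> //.
- exact: lin.1.
- have nd : normal_derivatives f = normal_derivatives fs.
    rewrite fn (dtn_matrixP ks); congr (_ *m _).
    by apply/colP => v; rewrite !vertex_valuesE fsv.
  move=> v; split; first by rewrite vlin fsv mulN1r subrr.
  apply: etrans (nlin v) _; rewrite mulN1r; apply/eqP; rewrite subr_eq0; apply/eqP.
  apply: etrans (esym (normal_derivativesE f v 0)) _.
  exact: etrans (congr1 (fun A : 'cV_ _ => A v 0) nd) (normal_derivativesE fs v 0).
- exact: so2 r0.
- by move=> e; apply: aeeq_sym; exact: (schroedinger_represents q_q0 r0 e).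
Qed.

Lemma krein_action f g : krein_laplacian q f g -> gaeeq g (schroedinger q f).
Proof. by move=> [/adjointP[]]. Qed.

Lemma ker_krein f : ker (krein_laplacian q) f <-> kerS f.
Proof.
split=> [[]//|kf]; split=> //; exists (fun _ _ => 0), f; split=> //; last first.
  by move=> e; apply: aeW => x _; rewrite add0r.
eexists; apply: (S_op_intro q0_measurable q0_bounds q_q0 (F1 := fun _ _ => 0)
  (F2 := fun _ _ => 0)) => // [e|v].
  by split; exact: primitive_cst.
by rewrite big1// => p _; rewrite mulr0.
Qed.

End Kernel.

(** * Normalization of the potential *)

Section NonnegativeRepresentative.
Context {R : realType}.

(** Truncating a Borel representative to [[0, M]] changes it on a null set
    only. *)
Lemma nonnegative_borel_representative (l M : R) (q : R -> R) :
  0 <= M -> lebesgue_measurable_fun l q ->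
  (forall x, x \in `]0, l[ -> `|q x| <= M) ->
  (\forall x \ae (@lebesgue_measure R), x \in `]0, l[ -> 0 <= q x) ->
  exists q0 : R -> R, [/\ measurable_fun `]0, l[ q0,
    forall x, x \in `]0, l[ -> 0 <= q0 x <= M & aeeq l q q0].
Proof.
move=> M0 [h mh qh] qM q_ge0; exists (fun x => Num.min M (Num.max 0 (h x))); split.
- apply: measurable_minr; first exact: measurable_cst.
  by apply: measurable_maxr => //; exact: measurable_cst.
- by move=> x _; rewrite le_min M0 le_max lexx ge_min lexx.
- apply: ae_sub (ae_and qh q_ge0) => x [+ +] xl => /(_ xl) <- /(_ xl) qx.
  rewrite max_r// min_r//; apply: le_trans (qM x xl); exact: ler_norm.
Qed.

End NonnegativeRepresentative.

(** * The free case and the discrete Laplacian *)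

Section FreeKernel.
Context {R : realType} (G : metric_graph R).
Hypothesis G_connected : connected_graph G.
Implicit Types (e : edge G) (v i j : 'I_(nvert G)) (p : edge G * bool).

Lemma affine_slope (l : R) (F F1 F2 : R -> R[i]) : 0 < l ->
  primitive2 l F F1 F2 -> (forall x, x \in `]0, l[ -> F2 x = 0) ->
  forall x, x \in `[0, l] -> F1 x = l^-1%:C * (F l - F 0).
Proof.
move=> l0 [[_ Fx] [_ F1x]] F20.
have F1_cst x : x \in `[0, l] -> F1 x = F1 0.
  move=> xl; rewrite F1x// (@eq_cintegral _ _ _ (fun=> 0)) ?cintegral0 ?addr0//.
  by move=> t tx; apply: F20; exact: subset_oo0 (cc_le xl) _ tx.
move=> x xl; rewrite F1_cst// (Fx l) ?itv0l//.
rewrite (@eq_cintegral _ _ _ (fun=> F1 0)); last by move=> t /oo_cc; exact: F1_cst.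
rewrite cintegral_cst ?ltW// addrC addKr mulrCA -rmorphM mulVf ?gt_eqF//.
by rewrite rmorph1 mulr1.
Qed.

Let q0 : potential G := fun _ _ => 0.

Let q0_measurable e : measurable_fun `]0, len e[ (q0 e).
Proof. exact: measurable_cst. Qed.

Let q0_bounds e (x : R) : x \in `]0, len e[ -> 0 <= q0 e x <= 0.
Proof. by rewrite /q0 lexx. Qed.

Let q0_q0 e : aeeq (len e) (q0 e) (q0 e).
Proof. exact: aeW. Qed.

Definition opposite p : edge G * bool := (p.1, ~~ p.2).

(** On each edge the members of the kernel are affine, hence determined by their
    values at the two ends. *)
Lemma free_normal_derivative f v : ker (adjoint (S_op q0)) f ->
  normal_derivative f v = \sum_(p | loc p == v)
    (len p.1)^-1%:C * (vertex_value f v - vertex_value f (loc (opposite p))).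
Proof.
move=> /(ker_represents q0_measurable q0_bounds q0_q0 G_connected)[F [F1 [rf cf]]].
rewrite (normal_derivative_represents rf); apply: eq_bigr => -[e b] /eqP <-.
have [pF _ _] := rf e.
have slope := affine_slope (len_gt0 e) pF _.
rewrite !(vertex_value_represents rf)// /opposite /endpoint /outward /=.
have q0F x : x \in `]0, len e[ -> potential_mul q0 F e x = 0.
  by rewrite /potential_mul /q0 rmorph0 mul0r.
have [l0 ll] := (itv00 (len_gt0 e), itv0l (len_gt0 e)).
by case: b => /=; rewrite (slope q0F)// ?mul1r// mulN1r -mulrN opprB.
Qed.

(** An edge joining two distinct vertices contributes to the row of each of them;
    on both sides a loop contributes zero. *)
Lemma edge_laplacian e v (c : 'I_(nvert G) -> R[i]) :
  \sum_j (if v == j then (((src e == v) || (tgt e == v)) && (src e != tgt e))%:R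
          else - (joins e v j)%:R) * c j =
  (src e == v)%:R * (c v - c (tgt e)) + (tgt e == v)%:R * (c v - c (src e)).
Proof.
rewrite (bigD1 v)//= eqxx.
rewrite (eq_bigr (fun j => - ((joins e v j)%:R * c j))); last first.
  by move=> j /negPf jv; rewrite eq_sym jv mulNr.
rewrite sumrN /joins.
have pick_j (k : 'I_(nvert G)) (P : pred 'I_(nvert G)) : k != v ->
    (forall j, j != v -> P j = (j == k)) ->
    \sum_(j | j != v) (P j)%:R * c j = c k.
  move=> kv Pk; rewrite (bigD1 k)//= Pk// eqxx mul1r big1 ?addr0// => j.
  by move=> /andP[jv /negPf jk]; rewrite Pk// jk mul0r.
have [sv|sv] := eqVneq (src e) v; have [tv|tv] := eqVneq (tgt e) v.
- rewrite sv tv eqxx /= !subrr !mulr0 mul0r addr0 sub0r big1 ?oppr0// => j jv.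
  by rewrite [v == j]eq_sym (negPf jv) ?andbF /= mul0r.
- rewrite sv eq_sym tv /= !mul1r mul0r addr0; congr (_ - _).
  by apply: pick_j => // j jv; rewrite andbF orbF eq_sym.
- rewrite tv sv /= !mul1r mul0r add0r; congr (_ - _).
  by apply: pick_j => // j jv; rewrite andbT eq_sym.
- rewrite /= !mul0r addr0 sub0r big1 ?oppr0// => j _.
  by rewrite andbF mul0r.
Qed.

Lemma discrete_laplacian_row v (c : 'I_(nvert G) -> R[i]) :
  \sum_j (discrete_laplacian G v j)%:C * c j =
  \sum_(p | loc p == v) (len p.1)^-1%:C * (c v - c (loc (opposite p))).
Proof.
transitivity (\sum_e (len e)^-1%:C *
  ((src e == v)%:R * (c v - c (tgt e)) + (tgt e == v)%:R * (c v - c (src e)))).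
  under [RHS]eq_bigr do rewrite -edge_laplacian mulr_sumr.
  rewrite exchange_big /=; apply: eq_bigr => j _; rewrite !mxE.
  have toC (P : pred (edge G)) : (\sum_(e | P e) (len e)^-1)%:C =
      \sum_e (len e)^-1%:C * (P e)%:R :> R[i].
    rewrite rmorph_sum big_mkcond; apply: eq_bigr => e _.
    by case: (P e); rewrite ?mulr1 ?mulr0.
  have CN (x : R) : (- x)%:C = - x%:C :> R[i] by exact: rmorphN.
  case: eqP => [vj|_].
    rewrite toC mulr_suml; apply: eq_bigr => e _.
    by rewrite mulrA.
  rewrite CN toC mulNr mulr_suml -sumrN; apply: eq_bigr => e _.
  by rewrite mulNr mulrN mulrA.
rewrite [RHS]big_mkcond -(pair_bigA _ (fun e b => if loc (e, b) == v then
  (len e)^-1%:C * (c v - c (loc (opposite (e, b)))) else 0)) /=.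
apply: eq_bigr => e _; rewrite big_bool /loc /opposite /= addrC mulrDr.
by congr (_ + _); case: eqP => _; rewrite /= ?mul1r ?mul0r ?mulr0.
Qed.

Lemma discrete_laplacian_dtn :
  is_dtn q0 (map_mx (real_complex R) (discrete_laplacian G)).
Proof.
move=> f kf; apply/colP => v; rewrite normal_derivativesE mxE.
rewrite (free_normal_derivative v kf) -discrete_laplacian_row.
by apply: eq_bigr => j _; rewrite vertex_valuesE [X in _ = X * _]mxE.
Qed.

Lemma free_dtn_matrix :
  dtn_matrix q0 = map_mx (real_complex R) (discrete_laplacian G).
Proof.
apply: (is_dtn_inj q0_measurable q0_bounds q0_q0 G_connected).
- exact: (dtn_matrixP q0_measurable q0_bounds q0_q0 G_connected).
- exact: discrete_laplacian_dtn.
Qed.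

Lemma dom_free_krein f : dom (krein_laplacian q0) f <->
  [/\ tildeH 2 f, gH1 f &
      normal_derivatives f =
      map_mx (real_complex R) (discrete_laplacian G) *m vertex_values f].
Proof.
rewrite -free_dtn_matrix.
exact: (dom_krein q0_measurable q0_bounds q0_q0 G_connected).
Qed.

End FreeKernel.

Local Open Scope complex_scope.

Theorem proposition3p4 (R : realType) (G : metric_graph R) (q : potential G)
  (G_connected : connected_graph G)
  (q_measurable : forall e, lebesgue_measurable_fun (len e) (q e))
  (q_bounded : exists M : R, forall e x, x \in `]0, len e[ -> `|q e x| <= M)
  (q_ge0 : forall e, \forall x \ae (@lebesgue_measure R),
     x \in `]0, len e[ -> 0 <= q e x) :
  [/\ unique (is_dtn q) (dtn_matrix q),
      forall f g, krein_laplacian q f g -> gaeeq g (schroedinger q f),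
      forall f, dom (krein_laplacian q) f <->
        [/\ tildeH 2 f, gH1 f &
            normal_derivatives f = dtn_matrix q *m vertex_values f],
      has_dimension (ker (krein_laplacian q)) (nvert G) /\
      has_dimension (ker (adjoint (S_op q))) (nvert G) &
      forall f, dom (krein_laplacian (fun (_ : edge G) (_ : R) => 0)) f <->
        [/\ tildeH 2 f, gH1 f &
            normal_derivatives f
            = map_mx (real_complex R) (discrete_laplacian G)
              *m vertex_values f]].
Proof.
have [M qM] := q_bounded.
have /card_gt0P[e0 _] := edge_nonempty G.
have M0 : 0 <= M.
  have half : len e0 / 2 \in `]0, len e0[.
    by rewrite in_itv/= divr_gt0 ?len_gt0//= ltr_pdivrMr// ltr_pMr ?len_gt0 ?ltr1n.
  exact: le_trans (normr_ge0 _) (qM _ _ half).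
have /choice[q0 q0P] e : exists q0 : R -> R, [/\ measurable_fun `]0, len e[ q0,
    forall x, x \in `]0, len e[ -> 0 <= q0 x <= M & aeeq (len e) (q e) q0].
  exact: (nonnegative_borel_representative M0 (q_measurable e) (qM e) (q_ge0 e)).
have q0_measurable e : measurable_fun `]0, len e[ (q0 e) by have [] := q0P e.
have q0_bounds e x : x \in `]0, len e[ -> 0 <= q0 e x <= M.
  by have [_ + _] := q0P e; exact.
have q_q0 e : aeeq (len e) (q e) (q0 e) by have [] := q0P e.
split.
- split; first exact: (dtn_matrixP q0_measurable q0_bounds q_q0 G_connected).
  move=> A; apply: (is_dtn_inj q0_measurable q0_bounds q_q0 G_connected).
  exact: (dtn_matrixP q0_measurable q0_bounds q_q0 G_connected).
- exact: (krein_action q0_measurable q0_bounds q_q0 G_connected).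
- exact: (dom_krein q0_measurable q0_bounds q_q0 G_connected).
- split; apply: (has_dimension_ker q0_measurable q0_bounds q_q0 G_connected) => f.
    exact: (ker_krein q0_measurable q0_bounds q_q0 G_connected).
  by [].
- exact: (dom_free_krein G_connected).
Qed.
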